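(* Let $k$ be a field, let $A$ and $B$ be affine commutative integral domains over $k$ of Krull dimension one, let $\sigma,\sigma'$ be $k$-algebra automorphisms of $A$ and $B$ respectively, and let $\delta,\delta'$ be $k$-linear derivations of $A$ and $B$ respectively. If $A[x;\sigma]\cong B[x';\sigma']$ as $k$-algebras, then $A\cong B$ as $k$-algebras. If, in addition, $k$ has characteristic zero and $A[x;\delta]\cong B[x';\delta']$ as $k$-algebras, then $A\cong B$ as $k$-algebras.
   Context: An affine algebra over $k$ is a finitely generated $k$-algebra. Given a ring $R$, an automorphism $\sigma$ of $R$ and a $\sigma$-derivation $\delta$ of $R$ (an additive map with $\delta(rs)=\sigma(r)\delta(s)+\delta(r)s$), the skew polynomial ring $R[x;\sigma,\delta]$ is $R[x]$ as an additive abelian group, with multiplication extending that of $R$ and determined by $x\cdot r=\sigma(r)x+\delta(r)$ for $r\in R$. One writes $R[x;\sigma]$ when $\delta=0$, and $R[x;\delta]$ when $\sigma$ is the identity (so that $\delta$ is an ordinary derivation). *)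

(* Defs.v *)
From HB Require Import structures.
From mathcomp Require Import all_boot all_order all_algebra.
From mathcomp Require mpoly.

Set Implicit Arguments.
Unset Strict Implicit.
Unset Printing Implicit Defensive.

Import GRing.Theory.
Local Open Scope ring_scope.

(* K-linear sigma-derivations of a K-algebra A; a derivation in the usual
   sense is a sigma-derivation for sigma = idfun. *)
Record skewder (K : comNzRingType) (A : algType K) (sigma : A -> A) := SkewDer {
  skewder_map :> {linear A -> A};
  skewderM : forall r s : A,
    skewder_map (r * s) = sigma r * skewder_map s + skewder_map r * s
}.

Section SkewDer0.
Variables (K : comNzRingType) (A : algType K) (sigma : A -> A).

Fact skewder0_subproof (r s : A) :
  (\0 : {linear A -> A}) (r * s) =
    sigma r * (\0 : {linear A -> A}) s + (\0 : {linear A -> A}) r * s.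
Proof. by rewrite /= mulr0 mul0r addr0. Qed.

Definition skewder0 : skewder sigma := SkewDer skewder0_subproof.

End SkewDer0.

(* The skew polynomial ring A[x; sigma, delta], with coefficients on the left.
   It is an alias of {poly A}: it has the additive group of {poly A}, but its
   own product and scaling are declared below. *)
Definition skew_poly (K : comNzRingType) (A : algType K)
  (sigma : {lrmorphism A -> A}) (delta : skewder sigma) : Type := {poly A}.
Arguments skew_poly {K A} sigma delta.

Section SkewPoly.
Variables (K : comNzRingType) (A : algType K).
Variables (sigma : {lrmorphism A -> A}) (delta : skewder sigma).
Implicit Types (p q r : {poly A}) (a b c : A).

(* Left multiplication by x: x * (a x^i) = sigma(a) x^(i+1) + delta(a) x^i. *)
Definition skew_mulX (q : {poly A}) : {poly A} :=
  map_poly sigma q * 'X + map_poly delta q.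

(* (sum_i a_i x^i) * q = sum_i a_i (x * (x * ... (x * q))). *)
Definition skew_mul (p q : {poly A}) : {poly A} :=
  \sum_(i < size p) p`_i *: iter i skew_mulX q.

Definition skew_scale (a : K) (p : {poly A}) : {poly A} := a%:A *: p.

Fact coef_skew_mulX q i :
  (skew_mulX q)`_i = (if i == 0%N then 0 else sigma q`_i.-1) + delta q`_i.
Proof.
rewrite coefD coefMX (@coef_map_id0 _ _ delta) ?raddf0 //.
by case: eqP => // _; rewrite coef_map.
Qed.

Fact skew_mulXD : {morph skew_mulX : p q / p + q}.
Proof.
move=> p q; apply/polyP=> i.
rewrite [RHS]coefD !coef_skew_mulX !coefD !raddfD /=.
by case: eqP => _; rewrite ?add0r // addrACA.
Qed.

Fact skew_mulX0 : skew_mulX 0 = 0.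
Proof. by apply: (addrI (skew_mulX 0)); rewrite -skew_mulXD !addr0. Qed.

Fact skew_mulXZ c q :
  skew_mulX (c *: q) = sigma c *: skew_mulX q + delta c *: q.
Proof.
apply/polyP=> i.
rewrite [RHS]coefD !coefZ !coef_skew_mulX !coefZ skewderM mulrDr.
by rewrite addrA; case: eqP => _; rewrite ?mulr0 // rmorphM.
Qed.

Fact skew_mulX_iterD i : {morph iter i skew_mulX : p q / p + q}.
Proof. by move=> p q; elim: i => //= i ->; rewrite skew_mulXD. Qed.

Fact skew_mulX_iter0 i : iter i skew_mulX 0 = 0.
Proof. by elim: i => //= i ->; rewrite skew_mulX0. Qed.

Fact skew_mulX_sum n (F : 'I_n -> {poly A}) :
  skew_mulX (\sum_(i < n) F i) = \sum_(i < n) skew_mulX (F i).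
Proof. exact: (big_morph skew_mulX skew_mulXD skew_mulX0). Qed.

Fact skew_mul_wide n p q : (size p <= n)%N ->
  skew_mul p q = \sum_(i < n) p`_i *: iter i skew_mulX q.
Proof.
move=> le_pn; rewrite /skew_mul.
rewrite (big_ord_widen n (fun i => p`_i *: iter i skew_mulX q) le_pn).
rewrite big_mkcond /=; apply: eq_bigr => i _.
by case: ltnP => // /leq_sizeP -> //; rewrite scale0r.
Qed.

Fact skew_mulDl : left_distributive skew_mul +%R.
Proof.
move=> p q r; pose n := maxn (size p) (size q).
rewrite !(@skew_mul_wide n) ?leq_maxl ?leq_maxr ?size_polyD // -big_split.
by apply: eq_bigr => i _; rewrite coefD scalerDl.
Qed.

Fact skew_mulDr : right_distributive skew_mul +%R.
Proof.
move=> p q r; rewrite /skew_mul -big_split; apply: eq_bigr => i _.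
by rewrite skew_mulX_iterD scalerDr.
Qed.

Fact skew_mulZl c p q : skew_mul (c *: p) q = c *: skew_mul p q.
Proof.
rewrite (@skew_mul_wide (size p)) ?size_scale_leq // scaler_sumr.
by apply: eq_bigr => i _; rewrite coefZ scalerA.
Qed.

Fact skew_mul0l q : skew_mul 0 q = 0.
Proof. by rewrite /skew_mul size_poly0 big_ord0. Qed.

Fact skew_mulC c q : skew_mul c%:P q = c *: q.
Proof.
by rewrite (@skew_mul_wide 1) ?size_polyC_leq1 // big_ord1 coefC eqxx.
Qed.

Fact skew_mul_mulX p q : skew_mul (skew_mulX p) q = skew_mulX (skew_mul p q).
Proof.
have le_size : (size (skew_mulX p) <= (size p).+1)%N.
  apply/leq_sizeP=> i lt_pi; rewrite coef_skew_mulX.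
  have -> : p`_i = 0 by apply: (leq_sizeP _ _ (leqnn _)); apply: ltnW.
  have -> : p`_i.-1 = 0.
    by apply: (leq_sizeP _ _ (leqnn _)); case: i lt_pi.
  by rewrite !raddf0 addr0 if_same.
rewrite (skew_mul_wide _ le_size) [skew_mul p q]/skew_mul skew_mulX_sum.
under eq_bigr => i _ do rewrite coef_skew_mulX scalerDl.
under [RHS]eq_bigr => i _ do rewrite skew_mulXZ.
rewrite !big_split /=; congr (_ + _).
  by rewrite big_ord_recl /= scale0r add0r.
by rewrite big_ord_recr /= nth_default // raddf0 scale0r addr0.
Qed.

Fact skew_mulA : associative skew_mul.
Proof.
move=> p q r.
have iterE i : iter i skew_mulX (skew_mul q r)
             = skew_mul (iter i skew_mulX q) r.
  by elim: i => //= i ->; rewrite skew_mul_mulX.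
have addl : {morph skew_mul^~ r : u v / u + v}.
  by move=> u v; apply: skew_mulDl.
rewrite {2}/skew_mul (big_morph _ addl (skew_mul0l r)).
by apply: eq_bigr => i _; rewrite iterE skew_mulZl.
Qed.

Fact skew_mul1 : left_id 1 skew_mul.
Proof. by move=> q; rewrite -polyC1 skew_mulC scale1r. Qed.

Fact skewder1 : delta 1 = 0.
Proof.
have /eqP := skewderM delta 1 1.
by rewrite mulr1 rmorph1 mul1r mulr1 -subr_eq0 opprD addNKr oppr_eq0 => /eqP.
Qed.

Fact skew_mulX_exp i : iter i skew_mulX 1 = 'X^i.
Proof.
elim: i => [|i /= ->]; first by rewrite expr0.
apply/polyP=> j; rewrite coef_skew_mulX !coefXn.
have -> : delta (j == i)%:R = 0 by case: eqP; rewrite ?raddf0 ?skewder1.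
rewrite addr0; case: j => [|j] //=; rewrite eqSS.
by case: eqP => _; rewrite ?rmorph0 ?rmorph1.
Qed.

Fact skew_mulr1 : right_id 1 skew_mul.
Proof.
move=> p; rewrite /skew_mul -[RHS]coefK poly_def.
by apply: eq_bigr => i _; rewrite skew_mulX_exp.
Qed.

Fact skew_scaleA (a b : K) p :
  skew_scale a (skew_scale b p) = skew_scale (a * b) p.
Proof. by rewrite /skew_scale scalerA -scalerAl mul1r scalerA. Qed.

Fact skew_scale1 : left_id 1 skew_scale.
Proof. by move=> p; rewrite /skew_scale !scale1r. Qed.

Fact skew_scaleDr : right_distributive skew_scale +%R.
Proof. by move=> a p q; rewrite /skew_scale scalerDr. Qed.

Fact skew_scaleDl p : {morph skew_scale^~ p : a b / a + b}.
Proof. by move=> a b; rewrite /skew_scale !scalerDl. Qed.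

Fact skew_scaleAl (a : K) p q :
  skew_scale a (skew_mul p q) = skew_mul (skew_scale a p) q.
Proof. by rewrite /skew_scale skew_mulZl. Qed.

Fact skew_mulX_scale (a : K) q :
  skew_mulX (skew_scale a q) = skew_scale a (skew_mulX q).
Proof.
rewrite /skew_scale skew_mulXZ !linearZ /= rmorph1 skewder1.
by rewrite scaler0 scale0r addr0.
Qed.

Fact skew_scaleAr (a : K) p q :
  skew_scale a (skew_mul p q) = skew_mul p (skew_scale a q).
Proof.
rewrite /skew_mul {1}/skew_scale scaler_sumr; apply: eq_bigr => i _.
have -> : iter i skew_mulX (skew_scale a q) = skew_scale a (iter i skew_mulX q).
  by elim: (nat_of_ord i) => //= n ->; rewrite skew_mulX_scale.
by rewrite /skew_scale !scalerA -scalerAl -scalerAr mul1r mulr1.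
Qed.

HB.instance Definition _ := GRing.Zmodule.copy (skew_poly sigma delta) {poly A}.

HB.instance Definition _ := GRing.Zmodule_isNzRing.Build
  (skew_poly sigma delta)
  skew_mulA skew_mul1 skew_mulr1 skew_mulDl skew_mulDr (oner_neq0 {poly A}).

HB.instance Definition _ := GRing.Zmodule_isLmodule.Build K
  (skew_poly sigma delta)
  skew_scaleA skew_scale1 skew_scaleDr skew_scaleDl.

HB.instance Definition _ :=
  GRing.Lmodule_isLalgebra.Build K (skew_poly sigma delta) skew_scaleAl.

HB.instance Definition _ :=
  GRing.Lalgebra_isAlgebra.Build K (skew_poly sigma delta) skew_scaleAr.

Definition skewX : skew_poly sigma delta := ('X : {poly A}).
Definition skewC (a : A) : skew_poly sigma delta := (a%:P : {poly A}).

Lemma skewCD : {morph skewC : a b / a + b}.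
Proof. exact: polyCD. Qed.

Lemma skewCM : {morph skewC : a b / a * b}.
Proof. by move=> a b; rewrite [RHS]skew_mulC /skewC polyCM mul_polyC. Qed.

Lemma skewC1 : skewC 1 = 1.
Proof. by []. Qed.

Lemma skewCZ (k : K) a : skewC (k *: a) = k *: skewC a.
Proof.
apply: etrans (mul_polyC k%:A (a%:P)).
by rewrite /skewC -polyCM -scalerAl mul1r.
Qed.

Fact skew_mulX_mul p : skew_mul 'X p = skew_mulX p.
Proof.
by rewrite /skew_mul size_polyX !big_ord_recl big_ord0 !coefX scale0r scale1r
  add0r addr0.
Qed.

Lemma skewX_exp i : skewX ^+ i = ('X^i : {poly A}).
Proof.
elim: i => [|i IHi]; first by rewrite !expr0.
by rewrite exprS IHi [LHS]skew_mulX_mul -!skew_mulX_exp.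
Qed.

Lemma skewXC a : skewX * skewC a = skewC (sigma a) * skewX + skewC (delta a).
Proof.
rewrite [LHS]skew_mulX_mul [skewC _ * _]skew_mulC /skew_mulX /skewC map_polyC.
rewrite mul_polyC; congr (_ + _); apply/polyP=> i.
rewrite (@coef_map_id0 _ _ delta) ?raddf0 // !coefC.
by case: eqP; rewrite ?raddf0.
Qed.

Lemma skew_polyE (p : skew_poly sigma delta) :
  p = \sum_(i < size (p : {poly A})) skewC (p : {poly A})`_i * skewX ^+ i.
Proof.
rewrite -[LHS](coefK (p : {poly A})) poly_def; apply: eq_bigr => i _.
by rewrite skewX_exp [RHS]skew_mulC.
Qed.

End SkewPoly.

Definition alg_iso (K : nzRingType) (A B : algType K) : Prop :=
  exists f : {lrmorphism A -> B}, bijective f.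

(* A is a quotient of a polynomial ring K[X_1, ..., X_n]. *)
Definition affine_alg (K : comNzRingType) (A : comAlgType K) : Prop :=
  exists (n : nat) (x : 'I_n -> A),
    forall a : A, exists p : mpoly.mpoly n K, mpoly.mmap (in_alg A) x p = a.

(* idealr_closed includes properness (1 \notin P); MathComp ideals are boolean
   predicates, which under informative excluded middle covers every ideal. *)
Definition prime_ideal (R : comNzRingType) (P : {pred R}) : Prop :=
  idealr_closed P /\ prime_idealr_closed P.

(* A chain P_0 < P_1 < ... < P_n of n.+1 prime ideals, of length n. *)
Definition prime_chain (R : comNzRingType) (n : nat) (P : 'I_n.+1 -> {pred R}) :
    Prop :=
  (forall i, prime_ideal (P i)) /\
  (forall i j : 'I_n.+1, (i < j)%N ->
     {subset P i <= P j} /\ ~ {subset P j <= P i}).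

Definition has_krull_dim (R : comNzRingType) (d : nat) : Prop :=
  (exists P : 'I_d.+1 -> {pred R}, prime_chain P) /\
  (forall (n : nat) (P : 'I_n.+1 -> {pred R}), prime_chain P -> (n <= d)%N).

(* Main.v *)
Require Import Defs.
From HB Require Import structures.
From mathcomp Require Import all_boot all_order all_algebra.
From mathcomp Require mpoly classical_sets.
From mathcomp Require Import boolp ring zify.

(** Let f be an isomorphism from R = A[x; sigma, delta] onto R' = B[x'; sigma', delta'].
    If f maps A into B, then comparing degrees in x' shows that A and B are isomorphic
    ([const_iso]). In the remaining cases A and B turn out to be polynomial rings
    in one variable over fields, and the fields are visible in A and B as the units
    together with zero ([line_over_units]); it then suffices to identify the two
    fields ([line_transfer]).

    Suppose first that sigma and sigma' are trivial. The units of R are those of A, so f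
    identifies the fields ([lines_iso]). The polynomial structure comes from an
    exponential map, that is, an action of the additive group. On R there is one that
    fixes a given a in A: the translations of x if R is commutative
    ([translation_exp_map]), and exp(ad a) if delta is nonzero and the characteristic is
    zero ([divided_power_exp_map]). Carried to R' by f, it fixes f(a), and a
    can be chosen such that f(a) has positive degree in x'. Now pass to leading forms
    with respect to x'. The leading form b x'^n of f(a) is fixed, and in a domain a
    factor of a fixed element is fixed; so x' is fixed ([leadingX]), and what remains is a
    nontrivial exponential map on B ([exp_map_coefficients]). A one-dimensional affine
    domain with a nontrivial exponential map is a polynomial ring over its ring of
    fixed elements, which is a field by the Nullstellensatz ([exp_map_line]).
    For delta = 0 this argument works in every characteristic and is a proof of the
    theorem of Abhyankar, Eakin and Heinzer on the cancellation of a variable.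

    Suppose now that delta = 0 and sigma is not trivial; then sigma' is not trivial
    either, as R' is not commutative. The constant term B[x'; sigma'] -> B is
    a ring morphism; composed with f, it is a surjection h from R onto B with
    h(x) h(a) = h(sigma(a)) h(x). If h(x) = 0, then h maps A onto B, and injectively
    because of the dimension. Otherwise h does not distinguish a from sigma(a), so its
    restriction to A has a nonzero kernel; its image is then a field, over which B is a
    polynomial ring in h(x) ([constant_term_cases]). By symmetry A is a polynomial ring
    over a field as well, and sigma, an affine substitution in the variable, has a
    fixed point, so h maps the units of A onto those of B ([fixed_point]). *)

Set Implicit Arguments.
Unset Strict Implicit.
Unset Printing Implicit Defensive.

Import GRing.Theory.
Local Open Scope ring_scope.

(** * Commutative domains as integral domain structures *)

(** A copy of [R], so that the inverses chosen classically below do not interfere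
    with the structures that [R] already has. *)
Definition dom_of (R : comNzRingType)
  (domR : GRing.integral_domain_axiom R) : Type := R.

Section DomOf.
Variables (R : comNzRingType) (domR : GRing.integral_domain_axiom R).

HB.instance Definition _ := GRing.ComNzRing.copy (dom_of domR) R.

Definition dom_unit : pred (dom_of domR) := fun x => `[< exists y, y * x = 1 >].

Definition dom_inv (x : dom_of domR) : dom_of domR :=
  if pselect (exists y, y * x = 1) is left ex then sval (cid ex) else x.

Fact dom_mulVx : {in dom_unit, left_inverse 1 dom_inv *%R}.
Proof.
move=> x /asboolP ex; rewrite /dom_inv.
by case: pselect => // ex'; case: cid.
Qed.

Fact dom_unitPl (x y : dom_of domR) : y * x = 1 -> dom_unit x.
Proof. by move=> yx1; apply/asboolP; exists y. Qed.

Fact dom_inv_out : {in [predC dom_unit], dom_inv =1 id}.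
Proof.
move=> x; rewrite inE /= => /asboolP nex; rewrite /dom_inv.
by case: pselect.
Qed.

HB.instance Definition _ := GRing.ComNzRing_hasMulInverse.Build (dom_of domR)
  dom_mulVx dom_unitPl dom_inv_out.
HB.instance Definition _ :=
  GRing.ComUnitRing_isIntegral.Build (dom_of domR) domR.

End DomOf.

Lemma inj_surj_bij (S T : Type) (f : S -> T) :
  injective f -> (forall y, exists x, f x = y) -> bijective f.
Proof.
move=> injf /choice[g gK]; exists g => // x.
by apply: injf; rewrite gK.
Qed.

(** * Finite generation *)

(** Generation is recorded as the induction principle it provides, which is the
    only form in which it gets used. *)
Definition generates (k A : nzRingType) (iota : k -> A) (us : seq A) :=
  forall P : A -> Prop,
    (forall c, P (iota c)) -> (forall u, u \in us -> P u) ->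
    (forall a b, P a -> P b -> P (a + b)) ->
    (forall a b, P a -> P b -> P (a * b)) ->
  forall a, P a.

Lemma affine_generates (k : comNzRingType) (A : comAlgType k) :
  affine_alg A -> exists us, generates (in_alg A) us.
Proof.
case=> n [x surj]; exists (codom x) => P Pk Px PD PM a.
have P0 : P 0 by rewrite -(rmorph0 (in_alg A)); apply: Pk.
have P1 : P 1 by rewrite -(rmorph1 (in_alg A)); apply: Pk.
have [p <-] := surj a; rewrite /mpoly.mmap.
elim/big_rec: _ => // m b _ Pb; apply: PD (Pb); apply: (PM); first exact: Pk.
rewrite /mpoly.mmap1; elim/big_rec: _ => // i c _ Pc; apply: (PM) (Pc).
elim: (mpoly.fun_of_multinom m i) => [|j IHj]; first by rewrite expr0.
by rewrite exprS; apply: PM => //; apply: Px; apply: codom_f.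
Qed.

(** * Integrality after inverting an element *)

Section Integral.
Variables (R : comNzRingType) (E : idomainType) (h : {rmorphism R -> E}).

(** A monic equation of least degree has a nonzero constant term, which exhibits a
    multiple of [z] in the base; over a field this makes [z] invertible. *)
Lemma integral_cofactor (z : E) : z != 0 -> integralOver h z ->
  exists w y, [/\ h w != 0, integralOver h y & z * y = h w].
Proof.
move=> z0 [p mon_p]; elim/poly_ind: p mon_p => [|p c IHp].
  by rewrite monicE lead_coef0 eq_sym oner_eq0.
have [-> | p0] := eqVneq p 0.
  rewrite mul0r add0r => /monicP; rewrite lead_coefC => ->.
  by rewrite map_polyC /= rmorph1 rootC oner_eq0.
move=> mon_pc; have mon_p : p \is monic.
  move: mon_pc; rewrite !monicE lead_coefDl ?lead_coefMX // size_mulX //.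
  by rewrite size_polyC; case: eqP => //= _; rewrite ltnS size_poly_gt0.
have pcE : (map_poly h (p * 'X + c%:P)).[z] = (map_poly h p).[z] * z + h c.
  by rewrite rmorphD rmorphM /= map_polyX map_polyC !hornerE.
move=> pcz; move: (pcz); rewrite rootE pcE.
have [hc | hc] := eqVneq (h c) 0.
  rewrite hc addr0 mulf_eq0 (negPf z0) orbF => pz0.
  by apply: IHp.
rewrite addr_eq0 => /eqP pz.
exists (- c), (map_poly h p).[z]; split; first by rewrite rmorphN oppr_eq0.
  have [q mon_q qz] : integralOver h z.
    by exists (p * 'X + c%:P).
  apply: integral_horner; last by exists q.
  by apply/integral_poly => i; rewrite coef_map; apply: integral_id.
by rewrite mulrC pz rmorphN.
Qed.

(** Integrality over R[1/d], with the denominators cleared so that the localization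
    need not be formed. *)
Definition integral_away (d : R) (z : E) := exists N, integralOver h (h d ^+ N * z).

Variable d : R.

Let integral_hd N : integralOver h (h d ^+ N).
Proof. by rewrite -rmorphXn; apply: integral_id. Qed.

Lemma integral_away_le N M z :
  (N <= M)%N -> integralOver h (h d ^+ N * z) -> integralOver h (h d ^+ M * z).
Proof. by move=> /subnK <- int_z; rewrite exprD -mulrA; apply: integral_mul. Qed.

Lemma integral_integral_away z : integralOver h z -> integral_away d z.
Proof. by exists 0%N; rewrite mul1r. Qed.

Lemma integral_away_add x y :
  integral_away d x -> integral_away d y -> integral_away d (x + y).
Proof.
move=> [N intx] [M inty]; exists (maxn N M); rewrite mulrDr.
by apply: integral_add; [apply: integral_away_le intx; apply: leq_maxl
 | apply: integral_away_le inty; apply: leq_maxr].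
Qed.

Lemma integral_away_mul x y :
  integral_away d x -> integral_away d y -> integral_away d (x * y).
Proof.
by move=> [N intx] [M inty]; exists (N + M)%N; rewrite exprD mulrACA;
  apply: integral_mul.
Qed.

Lemma integral_away_exp x n : integral_away d x -> integral_away d (x ^+ n).
Proof.
move=> intx; elim: n => [|n IHn].
  by rewrite expr0; apply/integral_integral_away/integral1.
by rewrite exprS; apply: integral_away_mul.
Qed.

Lemma integral_away_horner (p : {poly R}) z :
  integral_away d z -> integral_away d (map_poly h p).[z].
Proof.
move=> intz; rewrite horner_coef; elim/big_rec: _ => [|i x _ intx].
  by apply/integral_integral_away/integral0.
apply: integral_away_add intx; apply: integral_away_mul; last first.
  exact: integral_away_exp.
by rewrite coef_map; apply/integral_integral_away/integral_id.
Qed.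

(** The equation of h(d)^M z has the coefficients of that of [z] multiplied by
    positive powers of h(d)^M, except for the leading one; a large M makes all of
    them integral. *)
Lemma integral_away_root_monic (p : {poly E}) z :
  p \is monic -> root p z -> (forall i, integral_away d p`_i) ->
  integral_away d z.
Proof.
move=> mon_p pz0 /choice[N intp]; pose m := (size p).-1.
have sp : size p = m.+1 by rewrite polySpred ?monic_neq0.
pose M := (\max_(i < m) N i)%N; exists M.
pose q := \poly_(i < m.+1) (h d ^+ (M * (m - i)) * p`_i).
have pm : p`_m = 1 by move/monicP: mon_p; rewrite lead_coefE.
have qm : q`_m = 1 by rewrite coef_poly ltnS leqnn subnn muln0 expr0 mul1r pm.
have sq : size q = m.+1.
  apply/eqP; rewrite eqn_leq size_poly ltnNge; apply/negP.
  by move=> /leq_sizeP/(_ m (leqnn _)); rewrite qm => /eqP; rewrite oner_eq0.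
apply: (@integral_root_monic _ _ _ _ q).
- by rewrite monicE lead_coefE sq qm.
- suff qp : q.[h d ^+ M * z] = h d ^+ (M * m) * p.[z].
    by rewrite rootE qp (rootP pz0) mulr0.
  rewrite !horner_coef sq sp mulr_sumr; apply: eq_bigr => i _.
  rewrite coef_poly ltn_ord exprMn mulrACA -exprM -exprD -mulnDr.
  by rewrite subnK -1?ltnS // mulrA.
apply/integral_poly => i; rewrite coef_poly; case: ltnP => [|_]; last first.
  exact: integral0.
rewrite ltnS leq_eqVlt => /orP[/eqP-> | im].
  by rewrite subnn muln0 expr0 mul1r pm; apply: integral1.
apply: integral_away_le (intp i).
apply: (@leq_trans M); first exact: (@leq_bigmax _ (fun i : 'I_m => N i) (Ordinal im)).
by rewrite leq_pmulr // subn_gt0.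
Qed.

End Integral.

(** * Zariski's lemma *)

Section Zariski.
Variable E : fieldType.

(** The subring h(R)[us] of [E]. Recursing through the base ring R[X], rather than
    enlarging a subring of [E], keeps every ring in sight the image of an actual
    ring, over which [integralOver] makes sense. *)
Fixpoint adjoined (us : seq E) :
    forall R : comNzRingType, {rmorphism R -> E} -> E -> Prop :=
  if us is u :: us' then fun R h => @adjoined us' {poly R}
    (horner_eval u \o map_poly h : {rmorphism {poly R} -> E})
  else fun R h e => exists r, h r = e.

Lemma integral_away_mull (R : comNzRingType) (h : {rmorphism R -> E}) d d' z :
  integral_away h d z -> integral_away h (d * d') z.
Proof.
move=> [N intz]; exists N; rewrite rmorphM exprMn mulrAC.
by apply: integral_mul => //; rewrite -rmorphXn; apply: integral_id.
Qed.

(** The image of [R] becomes a field once [d] is inverted: every nonzero element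
    divides a power of [d]. Such rings are Goldman domains. *)
Definition goldman (R : comNzRingType) (h : {rmorphism R -> E}) d :=
  h d != 0 /\ forall e, h e != 0 -> exists e' N, h e * h e' = h d ^+ N.

(** In a polynomial ring over a domain, 1 + X c is prime to c, so it cannot divide
    a power of c: inverting one element never makes a polynomial ring a field. *)
Lemma goldman_algebraic (R : comNzRingType) (h : {rmorphism R -> E}) u c :
  goldman (horner_eval u \o map_poly h : {rmorphism {poly R} -> E}) c ->
  exists2 f : {poly R}, map_poly h f != 0 & (map_poly h f).[u] = 0.
Proof.
set hu := (_ \o _ : {rmorphism _ -> _}) => -[hc0 gc].
have huE p : hu p = (map_poly h p).[u] by [].
apply: contrapT => alg.
have {}alg (f : {poly R}) : hu f = 0 -> map_poly h f = 0.
  by move=> f0; apply: contrapT => /eqP f1; apply: alg; exists f.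
have hX : hu 'X = u by rewrite huE map_polyX hornerX.
pose e := 1 + 'X * c.
have e0 : hu e != 0.
  apply/eqP => /alg /polyP/(_ 0%N)/eqP.
  by rewrite rmorphD rmorphM /= map_polyX rmorph1 coefD coefXM coefC coef0 addr0 oner_eq0.
have [e' [N ee']] := gc _ e0.
have eu : exists w, map_poly h (e * w) = (-1) ^+ N.
  have [w ew] : exists w, (e - 1) ^+ N = (-1) ^+ N + e * w.
    elim: N {ee'} => [|N [w IH]]; first by exists 0; rewrite mulr0 addr0.
    exists ((e - 1) * w + (-1) ^+ N).
    by rewrite !exprS IH; ring.
  exists (e' * 'X^N - w); apply/eqP.
  rewrite -subr_eq0 -[(-1) ^+ N](rmorph_sign (map_poly h)) -rmorphB.
  apply/eqP/alg.
  have -> : e * (e' * 'X^N - w) - (-1) ^+ N = e * e' * 'X^N - ('X * c) ^+ N.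
    have -> : 'X * c = e - 1 by rewrite /e; ring.
    by rewrite ew; ring.
  by rewrite rmorphB !rmorphM !rmorphXn rmorphM exprMn ee' mulrC subrr.
have [w /(congr1 (fun p : {poly E} => size p))] := eu.
have -> : size ((-1) ^+ N : {poly E}) = 1%N.
  by rewrite -signr_odd; case: odd; rewrite ?expr1 ?size_polyN ?size_poly1.
rewrite rmorphM /=.
have hc1 : map_poly h c != 0.
  by apply: contra hc0 => /eqP hc; rewrite huE hc horner0.
have se : (1 < size (map_poly h e))%N.
  rewrite rmorphD rmorph1 rmorphM /= map_polyX addrC mulrC size_polyDl size_mulX //.
    by rewrite ltnS size_poly_gt0.
  by rewrite size_poly1 ltnS size_poly_gt0.
have [-> | w0] := eqVneq (map_poly h w) 0; first by rewrite mulr0 size_poly0.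
have e1 : map_poly h e != 0 by rewrite -size_poly_gt0 ltnW.
rewrite size_mul //; case: (size _) se => [|[|a]] // _.
by rewrite -size_poly_gt0 in w0; case: (size _) w0 => // b _; rewrite addnS.
Qed.

(** Once [u] and 1/c are integral over R[1/d], the field R[u][1/c] is integral over
    R[1/d], and a domain over which a field is integral is itself a field. *)
Lemma goldman_step (R : comNzRingType) (h : {rmorphism R -> E}) u c :
  goldman (horner_eval u \o map_poly h : {rmorphism {poly R} -> E}) c ->
  exists d, [/\ goldman h d, integral_away h d u
    & integral_away h d (map_poly h c).[u]^-1].
Proof.
move=> gc; have [f f0 fu0] := goldman_algebraic gc.
move: gc; set hu := (_ \o _ : {rmorphism _ -> _}) => -[hc0 gc].
have huE p : hu p = (map_poly h p).[u] by [].
have [l [hl intu]] : exists l, h l != 0 /\ integral_away h l u.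
  (* The leading coefficient of the image of f; that of f itself may vanish in E. *)
  exists f`_(size (map_poly h f)).-1.
  set l := f`_ _; have hl : h l != 0.
    by rewrite /l -coef_map /= -lead_coefE lead_coef_eq0.
  split=> //; pose g := (h l)^-1 *: map_poly h f.
  apply: (@integral_away_root_monic _ _ _ _ g).
  - by rewrite monicE lead_coefZ lead_coefE coef_map /= mulVf.
  - by rewrite rootE hornerZ fu0 mulr0.
  move=> i; exists 1%N; rewrite coefZ coef_map expr1 mulrA divff // mul1r.
  exact: integral_id.
have [N intc] := integral_away_horner c intu.
have c'0 : h l ^+ N * (map_poly h c).[u] != 0 by rewrite mulf_neq0 // expf_neq0.
have [w [y [hw inty cy]]] := integral_cofactor c'0 intc.
have intV : integral_away h (l * w) (map_poly h c).[u]^-1.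
  exists 1%N; have -> : h (l * w) ^+ 1 / (map_poly h c).[u] = h l * (h l ^+ N * y).
    by rewrite expr1 rmorphM -cy; field.
  apply: integral_mul; first exact: integral_id.
  by rewrite -rmorphXn; apply: integral_mul => //; apply: integral_id.
exists (l * w); split=> //; last exact: integral_away_mull.
split; first by rewrite rmorphM mulf_neq0.
move=> e he; have heu : hu e%:P != 0 by rewrite huE map_polyC hornerC.
have [e' [M ee']] := gc _ heu.
have eV : (h e)^-1 = (map_poly h e').[u] * (map_poly h c).[u]^-1 ^+ M.
  apply: (mulfI he); rewrite divff // mulrA.
  have -> : h e * (map_poly h e').[u] = (map_poly h c).[u] ^+ M.
    by rewrite -!huE -ee' (huE e%:P) map_polyC hornerC.
  by rewrite -exprMn divff // expr1n.
have [K [p mon_p]] : integral_away h (l * w) (h e)^-1.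
  rewrite eV; apply: integral_away_mul.
    by apply: integral_away_horner; apply: integral_away_mull.
  exact: integral_away_exp.
set b := h (l * w) => /rootP pz.
pose m := (size p).-1; have sp : size p = m.+1.
  by rewrite polySpred ?monic_neq0.
have pm : p`_m = 1 by move/monicP: mon_p; rewrite lead_coefE.
(* Solving the equation of h(d)^K / h(e) for its top term, after multiplication by
   h(e)^(m-1), writes h(d)^(K m) / h(e) as an element of h(R). *)
exists (- \sum_(i < m) p`_i * (l * w) ^+ (K * i) * e ^+ (m.-1 - i)), (K * m)%N.
move: pz; rewrite horner_coef size_map_poly_id0; last first.
  by rewrite (monicP mon_p) rmorph1 oner_neq0.
rewrite sp big_ord_recr coef_map /= pm rmorph1 mul1r => pz.
have m0 : (0 < m)%N.
  rewrite lt0n; apply/eqP => m0; move/eqP: pz.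
  by rewrite m0 big_ord0 add0r expr0 oner_eq0.
apply: (mulIf (expf_neq0 m (invr_neq0 he))).
rewrite exprM -exprMn; move/eqP: pz; rewrite addrC addr_eq0 => /eqP ->.
rewrite rmorphN mulrN mulNr rmorph_sum mulr_sumr mulr_suml; congr (- _).
apply: eq_bigr => i _; rewrite coef_map !rmorphM !rmorphXn /=.
have -> : (h e)^-1 ^+ m = (h e)^-1 * (h e)^-1 ^+ i * (h e)^-1 ^+ (m.-1 - i).
  by rewrite -mulrA -exprD -exprS; congr (_ ^+ _); have := ltn_ord i; lia.
have eeV n : h e ^+ n * (h e)^-1 ^+ n = 1 by rewrite -exprMn divff // expr1n.
rewrite exprMn -exprM -/b.
transitivity ((h e / h e) * (h e ^+ (m.-1 - i) * (h e)^-1 ^+ (m.-1 - i)) *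
  (h p`_i * (b ^+ (K * i) * (h e)^-1 ^+ i))); last first.
  by rewrite divff // eeV !mul1r.
by ring.
Qed.

(** Zariski's lemma is the case of a base field. The base is arbitrary because the
    induction moves one generator after the other into it. *)
Lemma goldman_descent us (R : comNzRingType) (h : {rmorphism R -> E}) c :
    adjoined us h c -> c != 0 ->
    (forall e, adjoined us h e -> e != 0 ->
      exists e' N, adjoined us h e' /\ e * e' = c ^+ N) ->
  exists d, goldman h d /\ forall z, adjoined us h z -> integral_away h d z.
Proof.
elim: us R h => [|u us IHus] R h.
  case=> d <- hd gd; exists d; split; first split=> //.
    move=> e he; have [|_ [N [[e' <-] ee']]] := gd (h e) _ he; first by exists e.
    by exists e', N.
  by move=> _ [r <-]; apply/integral_integral_away/integral_id.
move=> adj_c c0 gc; have [d1 [gd1 int1]] := IHus _ _ adj_c c0 gc.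
have [d [gd intu intV]] := goldman_step gd1.
exists d; split=> // z /int1[N [p mon_p pz]].
set v := (map_poly h d1).[u] in intV.
have v0 : v != 0 by case: gd1.
have -> : z = v ^+ N * z * v^-1 ^+ N.
  by rewrite mulrC mulrA -exprMn mulVf // expr1n mul1r.
apply: integral_away_mul (integral_away_exp _ intV).
apply: integral_away_root_monic pz _; first exact: monic_map.
by move=> i; rewrite coef_map; apply: integral_away_horner.
Qed.

End Zariski.

(** * Prime ideals and the Nullstellensatz *)

Definition ideal_closed (A : comNzRingType) (I : {pred A}) :=
  0 \in I /\ forall a, {in I &, forall u v, a * u + v \in I}.

Lemma ideal_closedMD (A : comNzRingType) (I : {pred A}) : ideal_closed I ->
  {in I &, forall u v, u + v \in I} /\ forall a, {in I, forall u, a * u \in I}.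
Proof.
case=> I0 IM; split=> [u v uI vI | a u uI].
  by rewrite -[u]mul1r IM.
by rewrite -[a * u]addr0 IM.
Qed.

(** An ideal maximal among those avoiding the powers of [c] is prime, and modulo it
    every nonzero element divides a power of [c]. *)
Lemma prime_avoiding (A : comNzRingType) (I : {pred A}) (c : A) :
  ideal_closed I -> (forall N, c ^+ N \notin I) ->
  exists M : {pred A}, [/\ prime_ideal M, {subset I <= M}, c \notin M
    & forall a, a \notin M -> exists N b, c ^+ N - a * b \in M].
Proof.
move=> idI cI.
pose ok (P : {pred A}) :=
  [/\ {subset I <= P}, ideal_closed P & forall N, c ^+ N \notin P].
pose T := {P : A -> bool | ok P}.
pose le (P Q : T) := `[< {subset sval P <= sval Q} >].
have okI : ok I by split.
have [| | |[M okM] Mmax] := @classical_sets.ZL_preorder T (exist ok I okI) le.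
- by move=> P; apply/asboolP.
- by move=> P Q S /asboolP PQ /asboolP QS; apply/asboolP => x /PQ/QS.
- move=> F totF.
  pose U := [pred a | (a \in I) || `[< exists2 s : T, F s & a \in sval s >]].
  have UP a : reflect (a \in I \/ exists2 s, F s & a \in sval s) (a \in U).
    by apply: (iffP orP) => -[]; [left|move/asboolP; right|left|right; apply/asboolP].
  have sFU s : F s -> {subset sval s <= U}.
    by move=> Fs x xs; apply/UP; right; exists s.
  have okU : ok U.
    split=> [x xI | | N]; first by apply/UP; left.
      split=> [|a u v]; first by apply/UP; left; case: idI.
      have sIP (s : T) : {subset I <= sval s} by case: s => P [].
      have idP (s : T) : ideal_closed (sval s) by case: s => P [].
      move=> /UP[uI | [s Fs us]] /UP[vI | [t Ft vt]].
      - by apply/UP; left; apply: (proj2 idI).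
      - apply: (sFU _ Ft); apply: (proj2 (idP t)) => //; exact: sIP.
      - apply: (sFU _ Fs); apply: (proj2 (idP s)) => //; exact: sIP.
      have [/asboolP st | /asboolP ts] := totF s t Fs Ft.
        by apply: (sFU _ Ft); apply: (proj2 (idP t)) => //; apply: st.
      by apply: (sFU _ Fs); apply: (proj2 (idP s)) => //; apply: ts.
    apply/UP => -[cNI | [[P [_ _ cP]] _ /= cNP]].
      by move: (cI N); rewrite cNI.
    by move: (cP N); rewrite cNP.
  exists (exist ok (U : A -> bool) okU) => s Fs; apply/asboolP; exact: sFU.
have [sIM idM cM] := okM; have [MD MM] := ideal_closedMD idM.
have avoid a : a \notin M -> exists N b, c ^+ N - a * b \in M.
  move=> aM; apply: contrapT => noN.
  pose Q := [pred x | `[< exists b, x - a * b \in M >]].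
  have okQ : ok Q.
    split=> [x xI | | N]; first by apply/asboolP; exists 0; rewrite mulr0 subr0 sIM.
      split=> [|b u v /asboolP[x ux] /asboolP[y vy]].
        by apply/asboolP; exists 0; rewrite mulr0 subr0; case: idM.
      apply/asboolP; exists (b * x + y).
      have -> : b * u + v - a * (b * x + y) = b * (u - a * x) + (v - a * y) by ring.
      exact: (proj2 idM).
    by apply/asboolP => -[b cb]; apply: noN; exists N, b.
  have /asboolP QM : le (exist ok (Q : A -> bool) okQ) (exist ok M okM).
    apply: Mmax; apply/asboolP => x /= xM; apply/asboolP.
    by exists 0; rewrite mulr0 subr0.
  move/negP: aM; apply; apply: QM; apply/asboolP; exists 1.
  by rewrite mulr1 subrr; case: idM.
exists M; split=> //; last by have := cM 1%N; rewrite expr1.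
split; first by have := cM 0%N; rewrite expr0; case: idM.
move=> u v uvM; apply/orP; case: (boolP (u \in M)) => uM; first by left.
case: (boolP (v \in M)) => vM; [by right | exfalso].
have [N [b cNu]] := avoid u uM; have [K [b' cKv]] := avoid v vM.
have /negP[] := cM (N + K)%N.
have -> : c ^+ (N + K) = c ^+ K * (c ^+ N - u * b) + (u * b * (c ^+ K - v * b')
  + b * b' * (u * v)) by rewrite exprD; ring.
by apply: (MD); [|apply: (MD)]; apply: (MM).
Qed.

Section PrimeQuotient.
Variables (A : comNzRingType) (M : {pred A}) (primeM : prime_ideal M).

(** The proof argument is a key: the ideal structures below are inferred from it. *)
Definition prime_pred of prime_ideal M : A -> bool := fun a => a \in M.
Local Notation P := (prime_pred primeM).

Fact prime_pred_closed : idealr_closed P.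
Proof. exact: (proj1 primeM). Qed.
Fact prime_pred_prime : prime_idealr_closed P.
Proof. exact: (proj2 primeM). Qed.

HB.instance Definition _ := isIdealr.Build A P prime_pred_closed.
HB.instance Definition _ := isPrimeIdealrClosed.Build A P prime_pred_prime.

Let PI : prime_idealr A := P.

Lemma prime_quotient :
  exists (L : idomainType) (eps : {rmorphism A -> L}),
    (forall z, exists a, eps a = z) /\ forall a, (eps a == 0) = (a \in M).
Proof.
pose Q : comNzRingType := {ideal_quot PI}%type.
have domQ : GRing.integral_domain_axiom Q.
  exact: (@Quotient.rquot_IdomainAxiom A PI).
pose pi : {rmorphism A -> Q} := \pi_({ideal_quot PI})%qT.
exists (dom_of domQ), pi; split=> [z | a].
  by exists (repr (z : {ideal_quot PI})); apply: reprK.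
have := @Quotient.idealrBE A PI a 0; rewrite subr0 => ->.
by have -> : (0 : dom_of domQ) = pi 0 by rewrite rmorph0.
Qed.

End PrimeQuotient.

Section Adjoined.
Variable E : fieldType.

Lemma adjoined_base us (R : comNzRingType) (h : {rmorphism R -> E}) r :
  adjoined us h (h r).
Proof.
elim: us R h r => [|u us IHus] R h r; first by exists r.
have := IHus _ (horner_eval u \o map_poly h : {rmorphism _ -> _}) r%:P.
by rewrite /= horner_evalE map_polyC hornerC.
Qed.

Lemma adjoined_mem us (R : comNzRingType) (h : {rmorphism R -> E}) u :
  u \in us -> adjoined us h u.
Proof.
elim: us R h => // v us IHus R h; rewrite inE => /orP[/eqP-> | /IHus]; last exact.
have := adjoined_base us (horner_eval v \o map_poly h : {rmorphism _ -> _}) 'X.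
by rewrite /= horner_evalE map_polyX hornerX.
Qed.

Lemma adjoinedD us (R : comNzRingType) (h : {rmorphism R -> E}) x y :
  adjoined us h x -> adjoined us h y -> adjoined us h (x + y).
Proof.
elim: us R h => [|u us IHus] R h; last exact: IHus.
by move=> [r <-] [s <-]; exists (r + s); rewrite rmorphD.
Qed.

Lemma adjoinedM us (R : comNzRingType) (h : {rmorphism R -> E}) x y :
  adjoined us h x -> adjoined us h y -> adjoined us h (x * y).
Proof.
elim: us R h => [|u us IHus] R h; last exact: IHus.
by move=> [r <-] [s <-]; exists (r * s); rewrite rmorphM.
Qed.

Lemma adjoined_min (P : E -> Prop) us (R : comNzRingType)
    (h : {rmorphism R -> E}) :
    (forall r, P (h r)) -> {in us, forall u, P u} ->
    (forall x y, P x -> P y -> P (x + y)) ->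
    (forall x y, P x -> P y -> P (x * y)) ->
  forall x, adjoined us h x -> P x.
Proof.
move=> + + PD PM; elim: us R h => [|u us IHus] R h Ph Pus x.
  by case=> r <-.
apply: IHus => [p | v vus] /=; last by apply: Pus; rewrite inE vus orbT.
have P0 : P 0 by rewrite -(rmorph0 h); apply: Ph.
rewrite horner_evalE horner_coef; elim/big_rec: _ => // i y _ Py.
apply: (PD) (Py); apply: (PM); first by rewrite coef_map; apply: Ph.
elim: (i : nat) => [|n IHn]; first by rewrite expr0 -(rmorph1 h); apply: Ph.
by rewrite exprS; apply: (PM) (IHn); apply: Pus; rewrite inE eqxx.
Qed.

End Adjoined.

(** A point of Spec A, algebraic over [k], at which [c] does not vanish: the quotient
    by a prime maximal among those avoiding [c] is a Goldman domain, hence algebraic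
    over [k] by Zariski's lemma. *)
Lemma nullstellensatz (k : fieldType) (A : comNzRingType)
    (iota : {rmorphism k -> A}) us (c : A) :
    generates iota us -> (forall N, c ^+ N != 0) ->
  exists (L : idomainType) (eps : {rmorphism A -> L}),
    eps c != 0 /\ forall a, integralOver (eps \o iota) (eps a).
Proof.
move=> gen_us c_nnil.
have [||M [primeM _ cM maxM]] := @prime_avoiding A (pred1 0) c.
- split=> [|a u v /eqP-> /eqP->]; first exact/eqP.
  by apply/eqP; rewrite mulr0 addr0.
- by move=> N; rewrite inE c_nnil.
have [L [eps [surj epsM]]] := prime_quotient primeM.
exists L, eps; split=> [|a]; first by rewrite epsM.
pose f : {rmorphism A -> {fraction L}} := @tofrac L \o eps.
have f0 x : (f x == 0) = (x \in M) by rewrite /= tofrac_eq0 epsM.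
pose h : {rmorphism k -> {fraction L}} := f \o iota.
have adj b : adjoined (map f us) h (f b).
  move: b; apply: gen_us => [r | u uus | x y adjx adjy | x y adjx adjy].
  - exact: adjoined_base.
  - by apply: adjoined_mem; apply: map_f.
  - by rewrite rmorphD; apply: adjoinedD.
  - by rewrite rmorphM; apply: adjoinedM.
have adjE e : adjoined (map f us) h e -> exists b, f b = e.
  move: e; apply: adjoined_min => [r | u /mapP[v _ ->] | _ _ [x <-] [y <-] | _ _ [x <-] [y <-]].
  - by exists (iota r).
  - by exists v.
  - by exists (x + y); rewrite rmorphD.
  - by exists (x * y); rewrite rmorphM.
have [||d [[hd _] /(_ _ (adj a))[N]]] := goldman_descent (adj c).
- by rewrite f0.
- move=> _ /adjE[b <-]; rewrite f0 => /maxM[N [b' cb]].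
  exists (f b'), N; split; first exact: adj.
  by apply/eqP; rewrite -rmorphM -rmorphXn eq_sym -subr_eq0 -rmorphB f0.
have d0 : d != 0 by apply: contra hd => /eqP->; rewrite rmorph0.
move=> intNa; have : integralOver h (f a).
  have -> : f a = h (d^-1 ^+ N) * (h d ^+ N * f a).
    by rewrite mulrA -rmorphXn -rmorphM -exprMn mulVf // expr1n rmorph1 mul1r.
  by apply: integral_mul => //; apply: integral_id.
case=> p mon_p; rewrite rootE => pa; exists p => //; rewrite rootE.
rewrite -tofrac_eq0 -[X in X == 0](horner_map (@tofrac L)) /= -map_poly_comp.
by move: pa; congr (_.[_] == _).
Qed.

(** * Exponential maps *)

(** Also known as a locally finite iterative higher derivation: the condition is that
    a |-> sum_n D_n(a) t^n be a coaction of the additive group. In characteristic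
    zero it amounts to a locally nilpotent derivation E, with D_n = E^n / n!. *)
Record exp_map (R : nzRingType) (D : nat -> R -> R) : Prop := ExpMap {
  exp_map0 : forall a, D 0%N a = a;
  exp_mapB : forall n, {morph D n : a b / a - b};
  exp_mapM : forall n a b, D n (a * b) = \sum_(i < n.+1) D i a * D (n - i)%N b;
  exp_map_finite : forall a, exists N, forall n, (N <= n)%N -> D n a = 0;
  exp_map_iter : forall i j a, D i (D j a) = D (i + j)%N a *+ 'C(i + j, i)
}.

Lemma exp_mapD (R : nzRingType) (D : nat -> R -> R) n a b :
  exp_map D -> D n (a + b) = D n a + D n b.
Proof.
move=> expD; have D0 : D n 0 = 0 by have := exp_mapB expD n 0 0; rewrite !subrr.
have DN v : D n (- v) = - D n v by rewrite -(sub0r v) (exp_mapB expD) D0 sub0r.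
by rewrite -{1}[b]opprK (exp_mapB expD) DN opprK.
Qed.

Lemma exp_map_at0 (R : nzRingType) (D : nat -> R -> R) n : exp_map D -> D n 0 = 0.
Proof. by move=> expD; have := exp_mapB expD n 0 0; rewrite !subrr. Qed.

Lemma exp_map_fixedD (R : nzRingType) (D : nat -> R -> R) a b : exp_map D ->
    (forall n, D n.+1 a = 0) -> (forall n, D n.+1 b = 0) ->
  forall n, D n.+1 (a + b) = 0.
Proof. by move=> expD Da Db n; rewrite (exp_mapD _ _ _ expD) Da Db addr0. Qed.

Lemma exp_map_fixedM (R : nzRingType) (D : nat -> R -> R) a b : exp_map D ->
    (forall n, D n.+1 a = 0) -> (forall n, D n.+1 b = 0) ->
  forall n, D n.+1 (a * b) = 0.
Proof.
move=> expD Da Db n; rewrite (exp_mapM expD) big1 // => -[[|i] /= ni] _.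
  by rewrite subn0 Db mulr0.
by rewrite Da mul0r.
Qed.

Lemma exp_map1 (R : nzRingType) (D : nat -> R -> R) n :
  exp_map D -> D n.+1 1 = 0.
Proof.
move=> expD; have [m] := ubnP n; elim: m n => // m IHm n nm.
have := exp_mapM expD n.+1 1 1; rewrite mulr1 big_ord_recl big_ord_recr /=.
rewrite big1 => [|i _]; last first.
  by rewrite /bump /= IHm ?mul0r //; apply: leq_trans (ltn_ord i) _.
rewrite /bump /= subn0 add1n subnn !(exp_map0 expD) mul1r mulr1 add0r.
by move=> E; apply: (addrI (D n.+1 1)); rewrite addr0 -E.
Qed.

Lemma exp_map_morphism (R : nzRingType) (D : nat -> R -> R) : exp_map D ->
  exists phi : {rmorphism R -> {poly R}}, forall a n, (phi a)`_n = D n a.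
Proof.
move=> expD; have /choice[N NP] := exp_map_finite expD.
pose phi a : {poly R} := \poly_(i < N a) D i a.
have phiE a n : (phi a)`_n = D n a.
  by rewrite coef_poly; case: ltnP => // /NP ->.
have phiB : zmod_morphism phi.
  by move=> a b; apply/polyP => n; rewrite coefB !phiE exp_mapB.
have phiM : monoid_morphism phi.
  split=> [|a b]; apply/polyP => n; last first.
    rewrite coefM phiE (exp_mapM expD).
    by apply: eq_bigr => i _; rewrite !phiE.
  by rewrite phiE coef1; case: n => [|n]; rewrite ?exp_map0 ?exp_map1.
exists (HB.pack_for {rmorphism R -> {poly R}} phi
  (GRing.isZmodMorphism.Build _ _ phi phiB)
  (GRing.isMonoidMorphism.Build _ _ phi phiM)).
exact: phiE.
Qed.

(** * Polynomial rings over their units *)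

Definition unit0 (A : comNzRingType) (a : A) := a = 0 \/ exists b, a * b = 1.

(** [A] is a polynomial ring U[t] in which the coefficient field U can be read off
    the ring [A] alone; hence isomorphisms have to respect it. *)
Record line_over_units (A : comNzRingType) (t : A) : Prop := LineOverUnits {
  unit0D : forall a b : A, unit0 a -> unit0 b -> unit0 (a + b);
  line_span : forall a, exists2 p : {poly A}, forall i, unit0 p`_i & p.[t] = a;
  line_free : forall p : {poly A}, (forall i, unit0 p`_i) -> p.[t] = 0 -> p = 0
}.

Lemma unit00 (A : comNzRingType) : unit0 (0 : A).
Proof. by left. Qed.

Lemma unit01 (A : comNzRingType) : unit0 (1 : A).
Proof. by right; exists 1; rewrite mulr1. Qed.

Lemma unit0M (A : comNzRingType) (a b : A) : unit0 a -> unit0 b -> unit0 (a * b).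
Proof.
case=> [->|[a' aa']]; first by rewrite mul0r; left.
case=> [->|[b' bb']]; first by rewrite mulr0; left.
by right; exists (a' * b'); rewrite mulrACA aa' bb' mulr1.
Qed.

Lemma unit0N (A : comNzRingType) (a : A) : unit0 a -> unit0 (- a).
Proof.
case=> [->|[a' aa']]; first by rewrite oppr0; left.
by right; exists (- a'); rewrite mulrNN.
Qed.

(** By Vandermonde's identity the property of [d] passes to d - m, hence to the
    remainder r of [d] modulo [m], and C(r, r) = 1 leaves only r = 0. *)
Lemma dvdn_bin_vanish (R : nzRingType) m d :
    (0 < m)%N ->
    (forall j, (0 < j < m)%N -> 'C(m, j)%:R = 0 :> R) ->
    (forall j, (0 < j < m)%N -> 'C(d, j)%:R = 0 :> R) ->
  (m %| d)%N.
Proof.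
move=> m0 binm; have [n] := ubnP d; elim: n d => // n IHn d dn bind.
have [dm | md] := ltnP d m.
  case: d bind {dn} dm => // d bind dm; have := bind d.+1; rewrite dm binn.
  by move=> /(_ isT)/eqP; rewrite oner_eq0.
rewrite -(subnK md) dvdn_addl //; apply: IHn; first lia.
move=> j /andP[j0 jm]; rewrite -(bind j) ?j0 // -{2}(subnK md) addnC.
rewrite -binomial.Vandermonde natr_sum big_ord_recl /= bin0 subn0 mul1n.
rewrite big1 ?addr0 // => i _; rewrite natrM binm ?mul0r //.
by rewrite /bump /=; have := ltn_ord i; lia.
Qed.

(** * One-dimensional domains with an exponential map *)

Section ExpMapLine.
Variables (k : fieldType) (A : idomainType) (iota : {rmorphism k -> A}).
Variables (us : seq A) (D : nat -> A -> A).
Hypotheses (gen_us : generates iota us) (expD : exp_map D).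
Hypothesis dimA : forall n (P : 'I_n.+1 -> {pred A}), prime_chain P -> (n <= 1)%N.

(** Otherwise 0 < ker f < ker g would be a chain of primes of length two. *)
Lemma kernel_chain (L L' : idomainType) (f : {rmorphism A -> L})
    (g : {rmorphism A -> L'}) a b :
    (forall x, f x = 0 -> g x = 0) -> f b <> 0 -> g b = 0 ->
  f a = 0 -> a = 0.
Proof.
move=> fg fb gb fa; apply: contrapT => a0.
pose P (i : 'I_3) : {pred A} :=
  if i == 0%N :> nat then pred1 0 else
  if i == 1%N :> nat then [pred x | f x == 0] else [pred x | g x == 0].
suff /dimA : prime_chain P by [].
have kerP (M : idomainType) (h : {rmorphism A -> M}) :
    prime_ideal ([pred x | h x == 0] : {pred A}).
  split; first split; rewrite ?inE ?rmorph0 ?rmorph1 ?oner_eq0 //.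
    move=> c x y; rewrite !inE rmorphD rmorphM => /eqP-> /eqP->.
    by rewrite mulr0 addr0.
  by move=> x y; rewrite !inE rmorphM mulf_eq0.
split=> [i | i j ij].
  rewrite /P; case: ifP => _; first exact: (kerP _ idfun).
  by case: ifP => _; apply: kerP.
case: i j ij => [[|[|[|//]]] iP] [[|[|[|//]]] jP] //= _; rewrite /P /=.
- split=> [x | /(_ a)]; rewrite !inE; first by move=> /eqP->; rewrite rmorph0.
  by rewrite fa eqxx => /(_ isT)/eqP.
- split=> [x | /(_ a)]; rewrite !inE; first by move=> /eqP->; rewrite rmorph0.
  by rewrite fg // eqxx => /(_ isT)/eqP.
split=> [x | /(_ b)]; rewrite !inE; first by move=> /eqP /fg ->.
by rewrite gb eqxx => /(_ isT)/eqP.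
Qed.

(** The degree of a is that of sum_n D_n(a) t^n in t. Let x have the least positive
    degree m. Every degree is a multiple of m, because D_i(a) has degree j for
    i = deg(a) - j as soon as the binomial C(deg(a), j) is nonzero in [A], which is
    impossible for 0 < j < m. Leading coefficients are fixed elements; so if the
    fixed ring is a field, then subtracting a multiple of a power of x lowers the
    degree, and every element is a polynomial in x over the fixed ring.

    The fixed ring is a field because it is algebraic over [k]. Indeed choose a point
    eps of [A], algebraic over [k], with eps(D_m(x)) <> 0. The kernel of the orbit map
    psi : a |-> sum_n eps(D_n(a)) t^n lies strictly inside that of eps, as psi(x) is
    not constant; since [A] has dimension one, psi is injective, and on the fixed ring
    it is eps. *)
Lemma exp_map_line a0 n0 : (0 < n0)%N -> D n0 a0 <> 0 ->
  exists t : A, line_over_units t.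
Proof.
have [phi phiE] := exp_map_morphism expD => n00 Dn0.
have phi0 a : (phi a)`_0 = a by rewrite phiE exp_map0.
have size_unit a b : a * b = 1 -> (size (phi a) <= 1)%N.
  move=> /(congr1 (fun c => size (phi c))); rewrite rmorphM rmorph1 size_poly1.
  have [-> | a1] := eqVneq (phi a) 0; first by rewrite size_poly0.
  have [-> | b1] := eqVneq (phi b) 0; first by rewrite mulr0 size_poly0.
  rewrite size_mul // -[size (phi b)]prednK ?size_poly_gt0 // addnS /=.
  by move=> sab; apply: leq_trans (leq_addr _ _) (eq_leq sab).
have size_unit0 (a : A) : unit0 a -> (size (phi a) <= 1)%N.
  by case=> [->|[b /size_unit //]]; rewrite rmorph0 size_poly0.
have phiC a : (size (phi a) <= 1)%N -> phi a = a%:P.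
  by move=> /size1_polyC ->; rewrite phi0.
have size_D j a : (size (phi (D j a)) <= size (phi a) - j)%N.
  apply/leq_sizeP => i ij; rewrite phiE exp_map_iter // -phiE.
  by rewrite (leq_sizeP _ _ (leqnn _)) ?mul0rn // addnC -leq_subLR.
pose moved m := `[< exists x, size (phi x) = m.+2 >].
have exm : exists m, moved m.
  exists (size (phi a0)).-2; apply/asboolP; exists a0.
  have : (n0 < size (phi a0))%N.
    by rewrite ltnNge; apply/negP => /leq_sizeP/(_ n0 (leqnn _)); rewrite phiE.
  by move: n00; lia.
case: (ex_minnP exm) => m1 /asboolP[x size_x] min_m1 {exm n0 n00 Dn0 a0}.
pose m := m1.+1; have {}min_m1 a : (size (phi a) <= m)%N -> (size (phi a) <= 1)%N.
  case E : (size (phi a)) => [|[|s]] //; rewrite /m ltnS => sm.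
  have /min_m1 : moved s by apply/asboolP; exists a.
  by rewrite leqNgt sm.
pose c0 := D m x.
have c00 : c0 != 0.
  rewrite /c0 -phiE -[m]/(m.+1.-1) -/m -size_x -lead_coefE lead_coef_eq0.
  by rewrite -size_poly_gt0 size_x.
have [|L [eps [eps_c0 int_eps]]] := nullstellensatz (c := c0) gen_us.
  by move=> N; rewrite expf_neq0.
pose psi : {rmorphism A -> {poly L}} := map_poly eps \o phi.
have psiC a : (size (phi a) <= 1)%N -> psi a = (eps a)%:P.
  by move=> /phiC; rewrite /psi /= => ->; rewrite map_polyC.
have size_iota c : (size (phi (iota c)) <= 1)%N.
  have [-> | c0'] := eqVneq c 0; first by rewrite !rmorph0 size_poly0.
  by apply: (size_unit _ (iota c^-1)); rewrite -rmorphM divff ?rmorph1.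
have size_psix : size (psi x) = m.+1.
  rewrite /psi /= size_map_poly_id0 ?size_x //.
  by rewrite lead_coefE size_x phiE.
(* The equation of eps(x) over k, evaluated at x, separates the two kernels. *)
have psi_inj a : psi a = 0 -> a = 0.
  have [q mon_q /rootP qx] := int_eps x.
  have qE : map_poly (eps \o iota) q = map_poly eps (map_poly iota q).
    by rewrite map_poly_comp.
  apply: (@kernel_chain _ _ _ eps _ (map_poly iota q).[x]).
  - by move=> y /polyP/(_ 0%N); rewrite coef_map phi0 coef0.
  - rewrite -horner_map -map_poly_comp.
    have -> : map_poly (psi \o iota) q = map_poly polyC (map_poly (eps \o iota) q).
      rewrite -map_poly_comp; apply: eq_map_poly => c; exact: psiC.
    apply/eqP; rewrite -/(_ \Po _) comp_poly_eq0 ?size_psix //.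
    by rewrite monic_neq0 // monic_map.
  by rewrite -horner_map -qx qE.
have unit_phi (s : A) : (size (phi s) <= 1)%N -> unit0 s.
  move=> size_s; have [-> | s0] := eqVneq s 0; [by left | right].
  have [q mon_q /rootP qs] := int_eps s.
  have int_s : integralOver iota s.
    exists q => //; apply/rootP/psi_inj; rewrite -horner_map -map_poly_comp.
    have -> : map_poly (psi \o iota) q = map_poly polyC (map_poly (eps \o iota) q).
      rewrite -map_poly_comp; apply: eq_map_poly => c; exact: psiC.
    by rewrite (psiC s) // horner_map qs.
  have [w [y [hw _ sy]]] := integral_cofactor s0 int_s.
  exists (y * iota w^-1); rewrite mulrA sy -rmorphM divff ?rmorph1 //.
  by apply: contra hw => /eqP->; rewrite rmorph0.
have unit0_add (a b : A) : unit0 a -> unit0 b -> unit0 (a + b).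
  move=> /size_unit0 sa /size_unit0 sb; apply: unit_phi; rewrite rmorphD.
  by apply: leq_trans (size_polyD _ _) _; rewrite geq_max sa.
have bin_vanish a d : size (phi a) = d.+1 ->
    forall j, (0 < j < m)%N -> 'C(d, j)%:R = 0 :> A.
  move=> size_a j /andP[j0 jm]; have [dj | jd] := ltnP d j.
    by rewrite bin_small.
  have /min_m1/phiC/polyP/(_ j) : (size (phi (D (d - j)%N a)) <= m)%N.
    by apply: leq_trans (size_D _ _) _; rewrite size_a; lia.
  rewrite phiE exp_map_iter // coefC gtn_eqF //= subnKC // -[D d a *+ _]mulr_natl.
  move/eqP; rewrite mulf_eq0 -phiE.
  have : lead_coef (phi a) != 0 by rewrite lead_coef_eq0 -size_poly_gt0 size_a.
  by rewrite lead_coefE size_a /= => /negPf ->; rewrite orbF => /eqP.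
have dvd_deg a d : size (phi a) = d.+1 -> (m %| d)%N.
  by move=> /bin_vanish; apply: dvdn_bin_vanish => //; apply: bin_vanish size_x.
have unit_c0 : unit0 c0.
  by apply: unit_phi; apply: leq_trans (size_D _ _) _; rewrite size_x subSnn.
have [u c0u] : exists u, c0 * u = 1 by case: unit_c0 c00 => // ->; rewrite eqxx.
have unit_u : unit0 u by right; exists c0; rewrite mulrC.
have unit_exp (v : A) e : unit0 v -> unit0 (v ^+ e).
  move=> uv; elim: e => [|e IHe]; first exact: unit01.
  by rewrite exprS; apply: unit0M.
exists x; split=> //.
- move=> a; have [n] := ubnP (size (phi a)).
  elim: n a => // n IHn a; case E : (size (phi a)) => [|d] an.
    exists 0 => [i|]; first by rewrite coef0; left.
    by rewrite horner0 -[a]phi0 (leq_sizeP _ _ (leqnn _)) // E.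
  have [e de] := dvdnP (dvd_deg _ _ E).
  (* u is the inverse of c0, so c x^e has the same leading term as a. *)
  pose c := D d a * u ^+ e.
  have unit_c : unit0 c.
    apply: unit0M; last exact: unit_exp.
    by apply: unit_phi; apply: leq_trans (size_D _ _) _; rewrite E subSnn.
  have size_xe : size (phi x ^+ e) = d.+1.
    have phix : phi x != 0 by rewrite -size_poly_gt0 size_x.
    rewrite -[size _]prednK ?size_poly_gt0 ?expf_neq0 //.
    by rewrite size_exp size_x de mulnC.
  have lead_xe : (phi x ^+ e)`_d = c0 ^+ e.
    rewrite -[d]/(d.+1.-1) -size_xe -lead_coefE lead_coef_exp.
    by rewrite lead_coefE size_x phiE.
  have [|p up pa] := IHn (a - c * x ^+ e).
    apply: (@leq_ltn_trans d) => //; apply/leq_sizeP => i di.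
    rewrite rmorphB rmorphM rmorphXn (phiC c) ?size_unit0 //.
    rewrite mul_polyC coefB coefZ; move: di; rewrite leq_eqVlt => /orP[/eqP<-|di].
      rewrite lead_xe /c -mulrA -exprMn [u * _]mulrC c0u expr1n mulr1 phiE.
      by rewrite subrr.
    by rewrite !(leq_sizeP _ _ (leqnn _)) ?E ?size_xe // mulr0 subr0.
  exists (p + c *: 'X^e) => [i|].
    rewrite coefD coefZ coefXn; apply: unit0_add => //.
    by case: eqP => _; rewrite ?mulr1 // mulr0; left.
  by rewrite !hornerE pa subrK.
move=> p up px; have : phi p.[x] = 0 by rewrite px rmorph0.
rewrite -horner_map.
have -> : map_poly phi p = map_poly polyC p.
  by apply/polyP => i; rewrite !coef_map /= phiC // size_unit0.
by move/eqP; rewrite -/(_ \Po _) comp_poly_eq0 ?size_x // => /eqP.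
Qed.

End ExpMapLine.

Lemma lrmorphism_of (k : comNzRingType) (A B : algType k) (g : A -> B) :
    zmod_morphism g -> monoid_morphism g -> scalable g ->
  exists g' : {lrmorphism A -> B}, g' =1 g.
Proof.
move=> gB gM gZ.
by exists (HB.pack_for {lrmorphism A -> B} g (GRing.isZmodMorphism.Build _ _ g gB)
  (GRing.isMonoidMorphism.Build _ _ g gM) (GRing.isScalable.Build _ _ _ _ g gZ)).
Qed.

(** * Identifying two polynomial rings over their units *)

(** The hypotheses on [h] concern only units and zero; elsewhere [h] may fail to be a
    ring morphism, as the constant term of a skew polynomial does. *)
Section LineTransfer.
Variables (k : fieldType) (A B : comAlgType k) (s : A) (t : B) (h : A -> B).
Hypotheses (lineA : line_over_units s) (lineB : line_over_units t).
Hypothesis hD : forall u v, unit0 u -> unit0 v -> h (u + v) = h u + h v.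
Hypothesis hM : forall u v, unit0 u -> unit0 v -> h (u * v) = h u * h v.
Hypothesis hk : forall c : k, h c%:A = c%:A.
Hypothesis h_unit : forall u, unit0 u -> unit0 (h u).
Hypothesis h_inj : forall u, unit0 u -> h u = 0 -> u = 0.
Hypothesis h_surj : forall v : B, unit0 v -> exists2 u : A, unit0 u & h u = v.

Let upoly (C : comNzRingType) (p : {poly C}) := forall i, unit0 p`_i.

Let h0 : h 0 = 0.
Proof. by rewrite -(scale0r (1 : A)) hk scale0r. Qed.

Let coef_h p i : (map_poly h p)`_i = h p`_i.
Proof. exact: coef_map_id0. Qed.

Let upoly_sum n (F : 'I_n -> A) : (forall i, unit0 (F i)) ->
  unit0 (\sum_i F i) /\ h (\sum_i F i) = \sum_i h (F i).
Proof.
elim: n F => [|n IHn] F uF.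
  by rewrite !big_ord0 h0; split=> //; apply: unit00.
have [|uS hS] := IHn (fun i => F (widen_ord (leqnSn n) i)); first by [].
rewrite !big_ord_recr /= hD // hS; split=> //.
exact: (unit0D lineA).
Qed.

Let upolyD p q : upoly p -> upoly q -> upoly (p + q) /\
  map_poly h (p + q) = map_poly h p + map_poly h q.
Proof.
move=> up uq; split=> [i|]; first by rewrite coefD; apply: (unit0D lineA).
by apply/polyP => i; rewrite coefD !coef_h coefD hD.
Qed.

Let upolyM p q : upoly p -> upoly q -> upoly (p * q) /\
  map_poly h (p * q) = map_poly h p * map_poly h q.
Proof.
move=> up uq.
have uF n (i : 'I_n.+1) : unit0 (p`_i * q`_(n - i)) by apply: unit0M.
split=> [i|]; first by rewrite coefM; case: (upoly_sum (uF i)).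
apply/polyP => i; rewrite coefM coef_h coefM.
rewrite (proj2 (upoly_sum (uF i))).
by apply: eq_bigr => j _; rewrite !coef_h hM.
Qed.

Let upolyC (u : A) : unit0 u -> upoly u%:P.
Proof. by move=> uu i; rewrite coefC; case: eqP => // _; left. Qed.

(** Apply [h] to the coefficients of the polynomial in [s]. *)
Lemma line_transfer : alg_iso A B.
Proof.
have /choice[P PP] a : exists p : {poly A}, upoly p /\ p.[s] = a.
  by have [p up pa] := line_span lineA a; exists p.
have P_uniq a p : upoly p -> p.[s] = a -> P a = p.
  move=> up pa; have [uP Pa] := PP a; apply/eqP; rewrite -subr_eq0; apply/eqP.
  apply: (line_free lineA) => [i|]; last by rewrite hornerD hornerN pa Pa subrr.
  by rewrite coefB; apply: (unit0D lineA) => //; apply: unit0N.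
pose F a := (map_poly h (P a)).[t].
have PD a b : P (a + b) = P a + P b.
  have [[uPa Pa] [uPb Pb]] := (PP a, PP b); apply: P_uniq.
    by case: (upolyD uPa uPb).
  by rewrite hornerD Pa Pb.
have PM a b : P (a * b) = P a * P b.
  have [[uPa Pa] [uPb Pb]] := (PP a, PP b); apply: P_uniq.
    by case: (upolyM uPa uPb).
  by rewrite hornerM Pa Pb.
have FD a b : F (a + b) = F a + F b.
  by rewrite /F PD (proj2 (upolyD _ _)) ?hornerD //; apply: (proj1 (PP _)).
have FM a b : F (a * b) = F a * F b.
  by rewrite /F PM (proj2 (upolyM _ _)) ?hornerM //; apply: (proj1 (PP _)).
have FC u : unit0 u -> F u = h u.
  move=> uu; rewrite /F (P_uniq _ u%:P) ?hornerC //; last exact: upolyC.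
  have -> : map_poly h u%:P = (h u)%:P; last by rewrite hornerC.
  by apply/polyP => i; rewrite coef_h !coefC; case: eqP.
have unit_k (c : k) : unit0 (c%:A : A).
  have [-> | c0] := eqVneq c 0; first by rewrite scale0r; left.
  right; exists (c^-1)%:A.
  by rewrite -scalerAl mul1r scalerA divff // scale1r.
have F0 : F 0 = 0 by rewrite FC ?h0 //; left.
have FN a : F (- a) = - F a.
  by apply: (addrI (F a)); rewrite -FD !subrr.
have [F' F'E] : exists F' : {lrmorphism A -> B}, F' =1 F.
  apply: lrmorphism_of => [a b||c a].
  - by rewrite FD FN.
  - split; last exact: FM.
    by rewrite FC; [have := hk 1; rewrite !scale1r | exact: unit01].
  by rewrite -[a in LHS]mul1r scalerAl FM FC // hk -scalerAl mul1r.
exists F'; apply: inj_surj_bij => [a b | y].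
  rewrite !F'E => Fab; apply/eqP; rewrite -subr_eq0; apply/eqP.
  have : F (a - b) = 0 by rewrite FD FN Fab subrr.
  have [uP Pab] := PP (a - b) => Fab0.
  suff P0 : P (a - b) = 0 by rewrite -Pab P0 horner0.
  apply/polyP => i; rewrite coef0; apply: h_inj => //.
  rewrite -coef_h; have -> : map_poly h (P (a - b)) = 0; last exact: coef0.
  by apply: (line_free lineB) => // j; rewrite coef_h; apply: h_unit.
have [q uq qy] := line_span lineB y.
have /choice[v vP] (i : nat) : exists u : A, unit0 u /\ h u = q`_i.
  by have [u uu hu] := h_surj (uq i); exists u.
pose p := \poly_(i < size q) v i.
have up : upoly p by move=> i; rewrite coef_poly; case: ifP => _; [case: (vP i) | left].
exists p.[s]; rewrite F'E /F (P_uniq _ p) // -qy; congr (_.[_]).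
apply/polyP => i; rewrite coef_h coef_poly; case: ltnP => [_ | qi].
  by case: (vP i).
by rewrite h0 (leq_sizeP _ _ (leqnn _)).
Qed.

End LineTransfer.

(** * Degrees in skew polynomial rings *)

Section SkewDegree.
Variables (k : fieldType) (A : comAlgType k).
Variables (sigma : {lrmorphism A -> A}) (delta : skewder sigma).
Local Notation R := (skew_poly sigma delta).
Implicit Types (p q : R) (a b : A).

Definition skew_coef p i : A := (p : {poly A})`_i.
Definition skew_size p : nat := size (p : {poly A}).

Lemma skew_coefP p q : (forall i, skew_coef p i = skew_coef q i) -> p = q.
Proof. exact: (proj1 (polyP p q)). Qed.

Lemma skew_sizeP p n :
  reflect (forall i, (n <= i)%N -> skew_coef p i = 0) (skew_size p <= n)%N.
Proof. exact: leq_sizeP. Qed.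

Lemma skew_coef_out p i : (skew_size p <= i)%N -> skew_coef p i = 0.
Proof. by move=> pi; apply: (skew_sizeP p (skew_size p) _). Qed.

Lemma skew_coef0 i : skew_coef 0 i = 0. Proof. exact: coef0. Qed.
Lemma skew_coefD p q i : skew_coef (p + q) i = skew_coef p i + skew_coef q i.
Proof. exact: coefD. Qed.
Lemma skew_coefB p q i : skew_coef (p - q) i = skew_coef p i - skew_coef q i.
Proof. exact: coefB. Qed.
Lemma skew_coefZ (c : k) p i : skew_coef (c *: p) i = c *: skew_coef p i.
Proof.
by rewrite -[skew_coef p i]mul1r scalerAl; apply: coefZ.
Qed.
Lemma skew_coef_sum n (F : 'I_n -> R) i :
  skew_coef (\sum_j F j) i = \sum_j skew_coef (F j) i.
Proof.
by apply: (big_morph (skew_coef^~ i)) => [p q|]; rewrite ?skew_coefD ?skew_coef0.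
Qed.
Lemma skew_coefC a i : skew_coef (skewC delta a) i = if i == 0%N then a else 0.
Proof. exact: coefC. Qed.
Lemma skew_coef1 i : skew_coef 1 i = (i == 0%N)%:R.
Proof. exact: coef1. Qed.
Lemma skew_coefXn n i : skew_coef (skewX delta ^+ n) i = (i == n)%:R.
Proof. by rewrite skewX_exp; apply: coefXn. Qed.

Lemma skew_coefCM a p i : skew_coef (skewC delta a * p) i = a * skew_coef p i.
Proof. by rewrite /skew_coef [skewC _ _ * _]skew_mulC coefZ. Qed.

Lemma skew_size_gt0 p : (0 < skew_size p)%N = (p != 0).
Proof. exact: size_poly_gt0. Qed.

Lemma skew_lead_neq0 p m : skew_size p = m.+1 -> skew_coef p m != 0.
Proof.
move=> sp; have : lead_coef (p : {poly A}) != 0.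
  by rewrite lead_coef_eq0 -size_poly_gt0 -/(skew_size p) sp.
by rewrite lead_coefE -/(skew_size p) sp.
Qed.

Lemma skew_size_eq p m :
  (skew_size p <= m.+1)%N -> skew_coef p m != 0 -> skew_size p = m.+1.
Proof.
move=> sp pm; apply/eqP; rewrite eqn_leq sp ltnNge; apply/negP => /skew_coef_out.
by move/eqP: pm.
Qed.

Lemma skew_const p : (skew_size p <= 1)%N -> p = skewC delta (skew_coef p 0).
Proof. exact: size1_polyC. Qed.

Lemma skew_sizeC a : (skew_size (skewC delta a) <= 1)%N.
Proof. exact: size_polyC_leq1. Qed.

Lemma skewC0 : skewC delta 0 = 0. Proof. exact: polyC0. Qed.

Lemma skewC_inj : injective (skewC delta).
Proof. exact: polyC_inj. Qed.

Lemma skew_sizeD p q n :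
  (skew_size p <= n)%N -> (skew_size q <= n)%N -> (skew_size (p + q)%R <= n)%N.
Proof.
by move=> /skew_sizeP p0 /skew_sizeP q0; apply/skew_sizeP => i ni;
  rewrite skew_coefD p0 ?q0 ?addr0.
Qed.

Lemma skew_size_sum m n (F : 'I_m -> R) :
  (forall i, skew_size (F i) <= n)%N -> (skew_size (\sum_i F i)%R <= n)%N.
Proof.
move=> sF; elim/big_rec: _ => [|i p _ sp]; last exact: skew_sizeD.
by apply/skew_sizeP => i _; rewrite skew_coef0.
Qed.

Lemma skew_size_iter q n i : (size (q : {poly A}) <= n)%N ->
  (size (iter i (skew_mulX delta) q) <= i + n)%N.
Proof.
move=> sq; elim: i => //= i IHi; apply/leq_sizeP => j ij.
rewrite coef_skew_mulX !(leq_sizeP _ _ IHi) ?raddf0; [by rewrite addr0 if_same | lia | lia].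
Qed.

Lemma skew_coef_iter q n i : (size (q : {poly A}) <= n.+1)%N ->
  (iter i (skew_mulX delta) q)`_(i + n) = iter i sigma (q : {poly A})`_n.
Proof.
move=> sq; elim: i => //= i IHi.
rewrite coef_skew_mulX /= IHi (leq_sizeP _ _ (skew_size_iter i sq)) ?raddf0 ?addr0 //.
lia.
Qed.

Lemma skew_size_mul p q m n :
    (skew_size p <= m.+1)%N -> (skew_size q <= n.+1)%N ->
  (skew_size (p * q)%R <= (m + n).+1)%N.
Proof.
move=> sp sq; apply/leq_sizeP => i mni.
rewrite [p * q](skew_mul_wide _ _ sp) coef_sum big1 // => j _.
rewrite coefZ (leq_sizeP _ _ (skew_size_iter j sq)) ?mulr0 //.
by have := ltn_ord j; lia.
Qed.

Lemma skew_coef_top p q m n :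
    (skew_size p <= m.+1)%N -> (skew_size q <= n.+1)%N ->
  skew_coef (p * q) (m + n) = skew_coef p m * iter m sigma (skew_coef q n).
Proof.
move=> sp sq; rewrite /skew_coef [p * q](skew_mul_wide _ _ sp) coef_sum.
rewrite big_ord_recr /= big1 => [|j _]; last first.
  rewrite coefZ (leq_sizeP _ _ (skew_size_iter j sq)) ?mulr0 //.
  by have := ltn_ord j; lia.
by rewrite add0r coefZ skew_coef_iter.
Qed.

Hypotheses (domA : GRing.integral_domain_axiom A) (sigma_inj : injective sigma).

Lemma skew_size_mulE p q m n :
  skew_size p = m.+1 -> skew_size q = n.+1 -> skew_size (p * q) = (m + n).+1.
Proof.
move=> sp sq; apply: skew_size_eq; first by rewrite skew_size_mul ?sp ?sq.
rewrite skew_coef_top ?sp ?sq //; apply/negP => /eqP/domA.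
rewrite (negPf (skew_lead_neq0 sp)) /=.
have iter_inj : injective (iter m sigma).
  by elim: (m) => //= i IHi a b /sigma_inj/IHi.
have : iter m sigma (skew_coef q n) != iter m sigma 0.
  by rewrite (inj_eq iter_inj) // skew_lead_neq0.
have -> : iter m sigma 0 = 0 by elim: (m) => //= i ->; rewrite rmorph0.
by move/negPf->.
Qed.

Lemma skew_size_exp p m i :
  skew_size p = m.+1 -> skew_size (p ^+ i) = (i * m).+1.
Proof.
move=> sp; elim: i => [|i IHi]; first by rewrite expr0 mul0n; apply: size_poly1.
by rewrite exprS mulSn; apply: skew_size_mulE.
Qed.

Lemma skew_unit_const p q : p * q = 1 -> (skew_size p <= 1)%N.
Proof.
move=> pq1; have s1 : skew_size (1 : R) = 1%N by apply: size_poly1.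
case sp : (skew_size p) => [|m] //; case sq : (skew_size q) => [|n].
  move: s1; rewrite -pq1; have -> : q = 0 by apply/eqP; rewrite -size_poly_eq0 -/(skew_size q) sq.
  by rewrite mulr0 /skew_size size_poly0.
by move: s1; rewrite -pq1 (skew_size_mulE sp sq); case: m {sp}.
Qed.

End SkewDegree.

(** * Isomorphisms of skew polynomial rings *)

Lemma lrmorphism_inverse (k : comNzRingType) (A B : algType k)
    (f : {lrmorphism A -> B}) : bijective f ->
  exists g : {lrmorphism B -> A}, cancel f g /\ cancel g f.
Proof.
case=> g fK gK'; have gK (y : B) : f (g y) = y := gK' y.
have f_inj (x y : A) : f x = f y -> x = y := @can_inj _ _ f g fK x y.
have gB (x y : B) : g (x - y) = g x - g y.
  by apply: f_inj; rewrite gK rmorphB /= !gK.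
have g1 : g 1 = 1 by apply: f_inj; rewrite gK rmorph1.
have gM (x y : B) : g (x * y) = g x * g y.
  by apply: f_inj; rewrite gK rmorphM /= !gK.
have gZ c (x : B) : g (c *: x) = c *: g x.
  by apply: f_inj; rewrite gK linearZ /= gK.
have [g' g'E] := @lrmorphism_of _ _ _ g gB (conj g1 gM) gZ.
by exists g'; split=> x; rewrite ?g'E // gK.
Qed.

Lemma alg_iso_sym (k : comNzRingType) (A B : algType k) :
  alg_iso A B -> alg_iso B A.
Proof.
by case=> f /lrmorphism_inverse[g [fK gK]]; exists g; exists f.
Qed.

Section SkewIso.
Variables (k : fieldType) (A B : comAlgType k).
Hypotheses (domA : GRing.integral_domain_axiom A).
Hypotheses (domB : GRing.integral_domain_axiom B).
Variables (sigma : {lrmorphism A -> A}) (delta : skewder sigma).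
Variables (sigma' : {lrmorphism B -> B}) (delta' : skewder sigma').
Hypotheses (sigma_inj : injective sigma) (sigma'_inj : injective sigma').
Local Notation R := (skew_poly sigma delta).
Local Notation R' := (skew_poly sigma' delta').
Variable f : {lrmorphism R -> R'}.
Hypothesis f_bij : bijective f.

(** The image of x has degree e > 0, as otherwise [f] would only reach constants. So [f]
    multiplies degrees by e, and only constants are mapped to constants. *)
Lemma const_iso :
  (forall a, (skew_size (f (skewC delta a)) <= 1)%N) -> alg_iso A B.
Proof.
move=> f_const; pose g a := skew_coef (f (skewC delta a)) 0.
have fC a : f (skewC delta a) = skewC delta' (g a) by apply: skew_const.
have f_inj := bij_inj f_bij.
have gB : zmod_morphism g.
  by move=> a b; rewrite /g -skew_coefB -rmorphB; congr (skew_coef (f _) 0); apply: polyCB.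
have gM : monoid_morphism g.
  split=> [|a b]; apply: (@skewC_inj _ _ _ delta'); rewrite -fC.
    by rewrite skewC1 rmorph1.
  by rewrite skewCM rmorphM /= !fC skewCM.
have gZ : scalable g.
  move=> c a; apply: (@skewC_inj _ _ _ delta'); rewrite -fC.
  by rewrite skewCZ linearZ /= fC skewCZ.
have [g' g'E] := lrmorphism_of gB gM gZ; exists g'.
have g_inj : injective g.
  by move=> a b gab; apply: (@skewC_inj _ _ _ delta); apply: f_inj; rewrite !fC gab.
apply: inj_surj_bij => [a b | b]; first by rewrite !g'E => /g_inj.
have [f' fK f'K] := f_bij.
have fE p : f p = \sum_(i < skew_size p) skewC delta' (g (skew_coef p i)) * f (skewX delta) ^+ i.
  rewrite {1}[p]skew_polyE rmorph_sum; apply: eq_bigr => i _.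
  by rewrite rmorphM rmorphXn /= fC.
have [e sX] : exists e, skew_size (f (skewX delta)) = e.+2.
  suff : (1 < skew_size (f (skewX delta)))%N.
    by case: (skew_size _) => [|[|e]] // _; exists e.
  rewrite ltnNge; apply/negP => sX.
  have : (skew_size (f (f' (skewX delta'))) <= 1)%N; last first.
    by rewrite f'K /skew_size size_polyX.
  rewrite fE; apply: skew_size_sum => i; apply/skew_sizeP => j j1.
  rewrite skew_coefCM [skew_coef (_ ^+ _) _]skew_coef_out ?mulr0 //; apply: leq_trans j1.
  elim: (i : nat) => [|n IHn]; first by rewrite expr0; apply: (skew_sizeC delta' 1).
  by rewrite exprS; apply: (@skew_size_mul _ _ _ _ _ _ 0 0).
pose p := f' (skewC delta' b); have fp : f p = skewC delta' b by apply: f'K.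
case sp : (skew_size p) => [|[|d]].
- exists 0; rewrite g'E; apply: (@skewC_inj _ _ _ delta'); rewrite -fC -fp.
  by congr (f _); apply: skew_coefP => i; rewrite (skew_coef_out (p := p)) ?sp // skew_coefC if_same.
- exists (skew_coef p 0); rewrite g'E; apply: (@skewC_inj _ _ _ delta').
  by rewrite -fC -skew_const ?sp.
have : skew_coef (f p) (d.+1 * e.+1) = 0 by rewrite fp skew_coefC.
rewrite fE sp skew_coef_sum big_ord_recr /= big1 => [|i _]; last first.
  rewrite skew_coefCM [skew_coef (_ ^+ _) _]skew_coef_out ?mulr0 // (skew_size_exp domB sigma'_inj i sX).
  by rewrite ltn_pmul2r.
rewrite add0r skew_coefCM => /domB/orP[] /eqP.
  have g0 : g 0 = 0 by rewrite -g'E rmorph0.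
  rewrite -[RHS]g0 => /g_inj /eqP.
  by rewrite (negPf (skew_lead_neq0 sp)).
by move/eqP; rewrite (negPf (skew_lead_neq0 (skew_size_exp domB sigma'_inj _ sX))).
Qed.

(** Units of a skew polynomial ring over a domain are constants, so [f] identifies the
    units of [A] with those of [B]. *)
Lemma lines_iso (s : A) (t : B) :
  line_over_units s -> line_over_units t -> alg_iso A B.
Proof.
move=> lineA lineB; pose h a := skew_coef (f (skewC delta a)) 0.
have [g [fK gK]] := lrmorphism_inverse f_bij.
have hC u : unit0 u -> f (skewC delta u) = skewC delta' (h u).
  case=> [->|[v uv]]; apply: skew_const.
    by rewrite skewC0 rmorph0 /skew_size size_poly0.
  apply: (@skew_unit_const _ _ _ _ domB sigma'_inj _ (f (skewC delta v))).
  by rewrite -rmorphM -skewCM uv skewC1 rmorph1.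
have hD u v : unit0 u -> unit0 v -> h (u + v) = h u + h v.
  by move=> _ _; rewrite /h skewCD rmorphD skew_coefD.
have skewC_inj' := @skewC_inj _ _ _ delta'.
apply: (line_transfer lineA lineB hD) => [u v uu uv | c | u uu | u uu hu0 | v uv].
- apply: skewC_inj'; rewrite skewCM -!hC //; last exact: unit0M.
  by rewrite skewCM rmorphM.
- by rewrite /h skewCZ linearZ /= skewC1 rmorph1 skew_coefZ skew_coef1.
- case: uu (uu) => [-> _|[v uv] uu].
    by left; apply: skewC_inj'; rewrite -hC; [rewrite !skewC0 rmorph0 | left].
  right; exists (h v); apply: skewC_inj'.
  rewrite skewCM -!hC //; last by right; exists u; rewrite mulrC.
  by rewrite -rmorphM -skewCM uv !skewC1 rmorph1.
- apply: (@skewC_inj _ _ _ delta); apply: (can_inj fK).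
  by rewrite hC // hu0 !skewC0 rmorph0.
have : (skew_size (g (skewC delta' v)) <= 1)%N.
  case: uv => [->|[w vw]].
    by rewrite skewC0 rmorph0 /skew_size size_poly0.
  apply: (@skew_unit_const _ _ _ _ domA sigma_inj _ (g (skewC delta' w))).
  by rewrite -rmorphM -skewCM vw skewC1 rmorph1.
move=> /skew_const; set u := skew_coef _ 0 => gv; exists u; last first.
  by rewrite /h -gv gK skew_coefC.
case: uv => [v0|[w vw]].
  by left; rewrite /u v0 skewC0 rmorph0 skew_coef0.
right; exists (skew_coef (g (skewC delta' w)) 0).
have gw : g (skewC delta' w) = skewC delta (skew_coef (g (skewC delta' w)) 0).
  apply/skew_const/(@skew_unit_const _ _ _ _ domA sigma_inj _ (g (skewC delta' v))).
  by rewrite -rmorphM -skewCM mulrC vw skewC1 rmorph1.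
apply: (@skewC_inj _ _ _ delta).
by rewrite skewCM -gv -gw -rmorphM -skewCM vw skewC1 rmorph1.
Qed.

End SkewIso.

(** * Leading forms of an exponential map *)

(** The degree in x is scaled by [s], and D_i is allowed to raise it by i r, so that
    the slope r / s need not be an integer. *)
Section Weight.
Variables (k : fieldType) (B : comAlgType k).
Variables (sigma : {lrmorphism B -> B}) (delta : skewder sigma).
Hypothesis sigma_id : forall b, sigma b = b.
Local Notation R := (skew_poly sigma delta).
Local Notation X := (skewX delta).
Local Notation C := (skewC delta).
Variable s : nat.
Hypothesis s_gt0 : (0 < s)%N.
Implicit Types (p q : R) (W V : nat).

Definition weight_le p W := forall j, (W < s * j)%N -> skew_coef p j = 0.
(** The coefficient at the possibly fractional degree W / s. *)
Definition top_coef p W := if (s %| W)%N then skew_coef p (W %/ s) else 0.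

Lemma weight_size p W : weight_le p W <-> (skew_size p <= (W %/ s).+1)%N.
Proof.
split=> [pW | /skew_sizeP pW j].
  by apply/skew_sizeP => j Wj; apply: pW; rewrite mulnC -ltn_divLR.
by rewrite mulnC -ltn_divLR // => /pW.
Qed.

Lemma weight_leW p W V : (W <= V)%N -> weight_le p W -> weight_le p V.
Proof. by move=> WV pW j Vj; apply: pW; apply: leq_ltn_trans Vj. Qed.

Lemma weight_le0 W : weight_le 0 W.
Proof. by move=> j _; apply: skew_coef0. Qed.

Lemma weight_leD p q W : weight_le p W -> weight_le q W -> weight_le (p + q) W.
Proof. by move=> pW qW j Wj; rewrite skew_coefD pW ?qW ?addr0. Qed.

Lemma weight_le_sum n (F : 'I_n -> R) W :
  (forall i, weight_le (F i) W) -> weight_le (\sum_i F i) W.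
Proof. by move=> FW j Wj; rewrite skew_coef_sum big1 // => i _; apply: FW. Qed.

Lemma weight_leM p q W V :
  weight_le p W -> weight_le q V -> weight_le (p * q) (W + V).
Proof.
move=> /weight_size pW /weight_size qV; apply/weight_size.
apply: leq_trans (skew_size_mul pW qV) _.
by rewrite ltnS leq_divRL // mulnDl leq_add // leq_divM.
Qed.

Lemma top_coefB p q W : top_coef (p - q) W = top_coef p W - top_coef q W.
Proof. by rewrite /top_coef; case: ifP => _; rewrite ?subr0 ?skew_coefB. Qed.

Lemma top_coefD p q W : top_coef (p + q) W = top_coef p W + top_coef q W.
Proof. by rewrite /top_coef; case: ifP => _; rewrite ?addr0 ?skew_coefD. Qed.

Lemma top_coef0 W : top_coef 0 W = 0.
Proof. by rewrite /top_coef skew_coef0 if_same. Qed.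

Lemma top_coef_sum n (F : 'I_n -> R) W :
  top_coef (\sum_i F i) W = \sum_i top_coef (F i) W.
Proof.
by apply: (big_morph (top_coef^~ W)) => [p q|]; rewrite ?top_coefD ?top_coef0.
Qed.

Lemma top_coefMn p n W : top_coef (p *+ n) W = top_coef p W *+ n.
Proof. by elim: n => [|n IHn]; rewrite ?mulr0n ?top_coef0 // !mulrS top_coefD IHn. Qed.

Lemma top_coef_lt p V W : (V < W)%N -> weight_le p V -> top_coef p W = 0.
Proof.
move=> VW pV; rewrite /top_coef; case: ifP => // /divnK sW.
by apply: pV; rewrite mulnC sW.
Qed.

Lemma top_coefM p q W V : weight_le p W -> weight_le q V ->
  top_coef (p * q) (W + V) = top_coef p W * top_coef q V.
Proof.
move=> pW qV; have /weight_size sp := pW; have /weight_size sq := qV.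
rewrite /top_coef; case: (boolP (s %| W)%N) => sW; last first.
  rewrite mul0r; case: ifP => // sWV; apply: skew_coef_out; apply: leq_trans (skew_size_mul sp sq) _.
  rewrite ltnNge; apply: contra sW => le_div; rewrite /dvdn.
  have := divn_eq W s; have := divn_eq V s; have := divnK sWV.
  move: le_div; set a := (_ %/ s)%N; set b := (V %/ s)%N; set c := (W %/ s)%N.
  move=> abc; have : (a * s <= c * s + b * s)%N.
    by rewrite -mulnDl leq_mul2r [(c + b)%N]addnC [(b + c)%N]addnC abc orbT.
  lia.
rewrite dvdn_addr //; case: ifP => sV; last by rewrite mulr0.
rewrite divnDl // skew_coef_top //; congr (_ * _).
by elim: (W %/ s)%N => //= n ->; rewrite sigma_id.
Qed.

Lemma top_coefC b : top_coef (C b) 0 = b.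
Proof. by rewrite /top_coef dvdn0 div0n skew_coefC. Qed.

Lemma weight_C b : weight_le (C b) 0.
Proof. by apply/weight_size; rewrite div0n skew_sizeC. Qed.

Section LeadingForms.
Variables (D : nat -> R -> R) (r : nat).
Hypothesis expD : exp_map D.

Definition adapted p W := forall i, weight_le (D i p) (W + i * r).
Definition leading p W i := top_coef (D i p) (W + i * r).

Lemma adaptedD p q W : adapted p W -> adapted q W -> adapted (p + q) W.
Proof. by move=> aW bW i; rewrite (exp_mapD _ _ _ expD); apply: weight_leD. Qed.

Lemma adaptedM p q W V : adapted p W -> adapted q V -> adapted (p * q) (W + V).
Proof.
move=> aW bV n; rewrite (exp_mapM expD); apply: weight_le_sum => i.
apply: (@weight_leW _ ((W + i * r) + (V + (n - i) * r))); last exact: weight_leM.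
by rewrite addnACA -mulnDl subnKC // -ltnS.
Qed.

Lemma leadingM p q W V n : adapted p W -> adapted q V ->
  leading (p * q) (W + V) n = \sum_(i < n.+1) leading p W i * leading q V (n - i).
Proof.
move=> aW bV; rewrite /leading (exp_mapM expD) top_coef_sum.
apply: eq_bigr => i _; rewrite -top_coefM //; congr top_coef.
by rewrite addnACA -mulnDl subnKC // -ltnS.
Qed.

Lemma leadingD p q W n : leading (p + q) W n = leading p W n + leading q W n.
Proof. by rewrite /leading (exp_mapD _ _ _ expD) top_coefD. Qed.

Lemma leading0 p W : leading p W 0 = top_coef p W.
Proof. by rewrite /leading mul0n addn0 (exp_map0 expD). Qed.

Lemma leading_lt p V W n : (V < W)%N -> adapted p V -> leading p W n = 0.
Proof. by move=> VW pV; apply: top_coef_lt (pV n); rewrite ltn_add2r. Qed.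

Lemma leading_poly p W : exists f : {poly B}, forall i, f`_i = leading p W i.
Proof.
have [N NP] := exp_map_finite expD p.
exists (\poly_(i < N) leading p W i) => i; rewrite coef_poly.
by case: ltnP => // /NP; rewrite /leading => ->; rewrite top_coef0.
Qed.

Hypothesis adaptedC : forall b, adapted (C b) 0.
Hypothesis adaptedX : adapted X s.

Lemma adaptedXn n : adapted (X ^+ n) (s * n).
Proof.
elim: n => [|n IHn]; first by rewrite expr0 muln0; apply: (adaptedC 1).
by rewrite exprS mulnS; apply: adaptedM.
Qed.

Lemma adapted_weight p W : weight_le p W -> adapted p W.
Proof.
move=> pW; rewrite [p]skew_polyE; elim/big_rec: _ => [i|i q _ aq].
  by rewrite (exp_map_at0 _ expD); apply: weight_le0.
apply: adaptedD aq; rewrite -/(skew_coef p i).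
have [lt_Wi | le_iW] := ltnP W (s * i).
  by rewrite pW // skewC0 mul0r => j; rewrite (exp_map_at0 _ expD); apply: weight_le0.
move=> j; apply: (@weight_leW _ (0 + s * i + j * r)); first by rewrite leq_add2r.
exact: (adaptedM (adaptedC _) (@adaptedXn i)).
Qed.

Lemma leading_split p n i : (skew_size p <= n.+1)%N ->
  leading p (s * n) i = leading (C (skew_coef p n) * X ^+ n) (s * n) i.
Proof.
move=> sp; set m := _ * _.
have {1}-> : p = m + (p - m) by rewrite addrC subrK.
rewrite leadingD; suff -> : leading (p - m) (s * n) i = 0 by rewrite addr0.
have spm j : (n <= j)%N -> skew_coef (p - m) j = 0.
  rewrite leq_eqVlt => /orP[/eqP<-|nj];
    rewrite skew_coefB skew_coefCM skew_coefXn ?eqxx ?mulr1 ?subrr //.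
  by rewrite gtn_eqF // mulr0 subr0 skew_coef_out //; apply: leq_trans nj.
clearbody m; case: n {sp} m spm => [|n] m spm.
  suff -> : p - m = 0 by rewrite /leading (exp_map_at0 _ expD) top_coef0.
  by apply: skew_coefP => j; rewrite spm // skew_coef0.
apply: (@leading_lt _ (s * n)); first by rewrite ltn_pmul2l.
apply: adapted_weight => j; rewrite ltn_pmul2l //; exact: spm.
Qed.

(** The leading forms of the D_i make up a multiplicative map into polynomials over
    [B]. The fixed element [p], with leading term b x^n, gets mapped to b, so the image
    of x, whose n-th power divides this constant, is itself constant. *)
Lemma leadingX (domB : GRing.integral_domain_axiom B) p e :
    skew_size p = e.+2 -> (forall n, D n.+1 p = 0) ->
  forall n, leading X s n.+1 = 0.
Proof.
move=> sp Dp; pose b := skew_coef p e.+1.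
have [fX fXE] := leading_poly X s; have [fb fbE] := leading_poly (C b) 0.
have fXnE n : forall i, (fX ^+ n)`_i = leading (X ^+ n) (s * n) i.
  elim: n => [|n IHn] i.
    rewrite !expr0 muln0; case: i => [|i]; rewrite coef1.
      by rewrite leading0 (top_coefC 1).
    by rewrite /leading (exp_map1 _ expD) top_coef0.
  rewrite !exprS mulnS (leadingM _ adaptedX (@adaptedXn n)) coefM.
  by apply: eq_bigr => j _; rewrite fXE IHn.
have prodE : fb * fX ^+ e.+1 = b%:P.
  apply/polyP => i; rewrite coefM coefC.
  have -> : \sum_(j < i.+1) fb`_j * (fX ^+ e.+1)`_(i - j) = leading p (s * e.+1) i.
    rewrite leading_split ?sp // -[(s * e.+1)%N]add0n.
    rewrite (leadingM _ (adaptedC b) (@adaptedXn e.+1)).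
    by apply: eq_bigr => j _; rewrite fbE fXnE.
  case: i => [|i]; last by rewrite /leading Dp top_coef0.
  by rewrite leading0 /top_coef dvdn_mulr // mulKn.
have b0 : b != 0 by apply: skew_lead_neq0 sp.
move: (fb : {poly dom_of domB}) (fX : {poly dom_of domB}) prodE fXE => g h gh hE n.
suff sh : (size h <= 1)%N.
  by rewrite -hE; apply: (leq_sizeP _ _ sh).
have gh' : g * h ^+ e.+1 = (b : dom_of domB)%:P := gh.
have h0 : h != 0.
  by apply: contra b0 => /eqP h0; move: gh'; rewrite h0 exprS mul0r mulr0 => /esym/eqP; rewrite polyC_eq0.
have g0 : g != 0.
  by apply: contra b0 => /eqP h0'; move: gh'; rewrite h0' mul0r => /esym/eqP; rewrite polyC_eq0.
have := congr1 (fun q : {poly dom_of domB} => (size q).-1) gh'.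
rewrite size_mul ?expf_neq0 // size_polyC b0 /=.
have := size_exp h e.+1; move: g0; rewrite -size_poly_gt0.
case: (size g) => // a _; case: (size h) => [|[|c]] //; rewrite /= mulSn.
by case: (size (h ^+ e.+1)) => [|[|z]] ; rewrite ?addSn ?addnS.
Qed.

Hypothesis lead_X : forall n, leading X s n.+1 = 0.

Lemma leadingXn n i : leading (X ^+ n) (s * n) i = (i == 0%N)%:R.
Proof.
elim: n i => [|n IHn] i.
  rewrite expr0 muln0; case: i => [|i]; first by rewrite leading0 (top_coefC 1).
  by rewrite /leading (exp_map1 _ expD) top_coef0.
rewrite exprS mulnS (leadingM _ adaptedX (@adaptedXn n)).
rewrite big_ord_recl big1 ?addr0 => [|j _]; last by rewrite lead_X mul0r.
rewrite leading0 subn0 IHn /top_coef dvdnn divnn s_gt0.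
by rewrite -[X in skew_coef X]expr1 skew_coefXn mul1r.
Qed.

Definition leading_map i b := leading (C b) 0 i.

(** Taking leading forms commutes with [D] because x is fixed to leading order. This is
    what makes the maps on coefficients iterative. *)
Lemma leading_mapE p W i : weight_le p W -> leading p W i = leading_map i (top_coef p W).
Proof.
move=> pW; have /weight_size sp := pW; rewrite /top_coef.
have [sW | sW] := boolP (s %| W)%N; last first.
  rewrite /leading_map skewC0 /leading (exp_map_at0 _ expD) top_coef0.
  apply: (@leading_lt _ (s * (W %/ s))).
    rewrite mulnC ltn_neqAle leq_divM andbT.
    by apply: contra sW => /eqP <-; apply: dvdn_mull.
  by apply/adapted_weight/weight_size; rewrite mulKn.
have WE : W = (s * (W %/ s))%N by rewrite mulnC divnK.
rewrite [in LHS]WE leading_split // -[(s * _)%N]add0n.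
rewrite (leadingM _ (adaptedC _) (@adaptedXn _)).
rewrite big_ord_recr big1 /= => [|j _].
  by rewrite subnn leadingXn mulr1 add0r.
rewrite leadingXn; case: eqP; last by rewrite mulr0.
by move/eqP; rewrite subn_eq0 leqNgt ltn_ord.
Qed.

Lemma leading_exp_map : exp_map leading_map.
Proof.
split=> [b | n a b | n a b | b | i j b].
- by rewrite /leading_map leading0 top_coefC.
- rewrite /leading_map /leading -top_coefB -(exp_mapB expD).
  by congr (top_coef (D _ _) _); apply: polyCB.
- by rewrite /leading_map skewCM -[0%N]/(0 + 0)%N leadingM.
- have [N NP] := exp_map_finite expD (C b).
  by exists N => n /NP; rewrite /leading_map /leading => ->; rewrite top_coef0.
have := leading_mapE i (@adaptedC b j); rewrite -[top_coef _ _]/(leading_map j b) => <-.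
rewrite /leading (exp_map_iter expD) top_coefMn /leading_map /leading.
by rewrite add0n mulnDl [(i * r + _)%N]addnC.
Qed.

End LeadingForms.
End Weight.

(** * Exponential maps on the coefficient ring *)

(** The pair (N, i) stands for the fraction N / i. *)
Lemma exists_max_ratio (t0 : nat * nat) (ts : seq (nat * nat)) :
    all (fun t => 0 < t.2)%N (t0 :: ts) ->
  exists2 t, t \in t0 :: ts & forall t', t' \in t0 :: ts -> (t.2 * t'.1 <= t'.2 * t.1)%N.
Proof.
elim: ts t0 => [|t1 ts IHts] t0 /andP[t00 ts0].
  by exists t0; rewrite ?inE // => t'; rewrite inE => /eqP->.
have ts_gt0 := allP (ts0 : all (fun t => 0 < t.2)%N (t1 :: ts)).
have [t tts tmax] := IHts _ ts0.
have t_gt0 : (0 < t.2)%N := ts_gt0 _ tts.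
have [le0 | lt0] := leqP (t.2 * t0.1) (t0.2 * t.1).
  exists t; first by rewrite inE tts orbT.
  by move=> t'; rewrite inE => /orP[/eqP->|/tmax].
exists t0; first by rewrite inE eqxx.
move=> t'; rewrite inE => /orP[/eqP->|tt' ]; first by rewrite mulnC.
rewrite -(leq_pmul2l t_gt0) mulnCA; apply: (@leq_trans (t'.2 * (t0.2 * t.1))).
  by rewrite [leqRHS]mulnCA leq_mul2l tmax ?orbT.
by rewrite [leqRHS]mulnCA leq_mul2l (ltnW lt0) orbT.
Qed.

Section Homogenize.
Variables (k : fieldType) (B : comAlgType k).
Variables (sigma : {lrmorphism B -> B}) (delta : skewder sigma).
Hypothesis sigma_id : forall b, sigma b = b.
Hypothesis domB : GRing.integral_domain_axiom B.
Local Notation R := (skew_poly sigma delta).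
Local Notation X := (skewX delta).
Local Notation C := (skewC delta).
Variables (us : seq B) (D : nat -> R -> R).
Hypotheses (gen_us : generates (in_alg B) us) (expD : exp_map D).
Hypothesis Dk : forall n (c : k), D n.+1 c%:A = 0.

(** Let r / s be the largest ratio (degree increase under D_i) / i, over i > 0 and over
    x and the finitely many generators of [B]. Then no D_i raises degrees by more than
    i r / s, and leading forms at this slope give the maps on [B]. The maximum is
    not reached at x, whose leading forms vanish by [leadingX]; so it is reached at a
    generator of [B], on which the maps are therefore nontrivial. *)
Lemma exp_map_coefficients p e b0 n0 :
    skew_size p = e.+2 -> (forall n, D n.+1 p = 0) -> D n0.+1 (C b0) <> 0 ->
  exists (d : nat -> B -> B) b n, exp_map d /\ d n.+1 b <> 0.
Proof.
move=> sp Dp Db0.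
have [u1 [n1 [u1us Du1]]] : exists u n, u \in us /\ D n.+1 (C u) <> 0.
  apply: contrapT => noD; apply: Db0; move: n0.
  move: b0; apply: gen_us => [c n | u uus n | a b Pa Pb | a b Pa Pb].
  - by rewrite [C _](skewCZ delta c 1) skewC1 Dk.
  - by apply: contrapT => Du; apply: noD; exists u, n.
  - by rewrite skewCD; apply: exp_map_fixedD.
  - by rewrite skewCM; apply: exp_map_fixedM.
have [N NP] : exists N, forall v n, v \in X :: map C us -> (N <= n)%N -> D n v = 0.
  elim: (X :: _) => [|v vs [N NP]]; first by exists 0%N.
  have [M MP] := exp_map_finite expD v; exists (maxn N M) => w n.
  by rewrite inE geq_max => /orP[/eqP->|wvs] /andP[Nn Mn]; [apply: MP | apply: NP].
(* The pairs (degree increase, i) from the generators, where D_i is nonzero. *)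
pose L1 := [seq ((skew_size (D vi.2 vi.1)).-1, vi.2) |
  vi <- [seq vi <- [seq (v, i) | v <- map C us, i <- iota 1 N] | D vi.2 vi.1 != 0]].
(* Those from x, leaving out the i for which the degree decreases. *)
pose L2 := [seq ((skew_size (D i X)).-2, i) |
  i <- [seq i <- iota 1 N | (1 < skew_size (D i X))%N]].
have L1P v i : v \in map C us -> (0 < i)%N -> D i v != 0 ->
    ((skew_size (D i v)).-1, i) \in L1.
  move=> vus i0 Dv; apply/mapP; exists (v, i) => //; rewrite mem_filter Dv /=.
  apply: allpairs_f => //; rewrite mem_iota i0 add1n ltnS ltnW // ltnNge.
  by apply: contra Dv => Ni; apply/eqP; apply: NP Ni; rewrite inE vus orbT.
have L2P i : (0 < i)%N -> (1 < skew_size (D i X))%N ->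
    ((skew_size (D i X)).-2, i) \in L2.
  move=> i0 sX; apply/mapP; exists i => //; rewrite mem_filter sX /=.
  rewrite mem_iota i0 add1n ltnS ltnW // ltnNge.
  apply: contraL sX => Ni; rewrite (NP X i (mem_head _ _) Ni).
  by rewrite /skew_size size_poly0.
have L_gt0 : all (fun t => 0 < t.2)%N (L1 ++ L2).
  rewrite all_cat; apply/andP; split; apply/allP => t /mapP[].
    move=> [v i]; rewrite mem_filter => /andP[_ /allpairsP[[w j]]] /= [_ + [_ ->]] ->.
    by rewrite mem_iota => /andP[].
  by move=> i; rewrite mem_filter mem_iota => /andP[_ /andP[i0 _]] ->.
have u1L : ((skew_size (D n1.+1 (C u1))).-1, n1.+1) \in L1 ++ L2.
  by rewrite mem_cat L1P // ?map_f //; apply/eqP.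
case E : (L1 ++ L2) => [|t0 ts]; first by rewrite E in u1L.
have [|[r s] rsL rs_max] := @exists_max_ratio t0 ts; first by rewrite -E.
rewrite -E in rsL rs_max; have s_gt0 : (0 < s)%N := allP L_gt0 _ rsL.
have w_size q W : (s * (skew_size q).-1 <= W)%N -> weight_le s q W.
  move=> qW j Wj; apply: skew_coef_out; have := leq_ltn_trans qW Wj.
  by rewrite ltn_pmul2l //; case: (skew_size q).
have adaptedC b : adapted s D r (C b) 0.
  move: b; apply: gen_us => [c | u uus | a b Pa Pb | a b Pa Pb].
  - case=> [|n]; first by rewrite (exp_map0 expD); apply: weight_C.
    by rewrite [C _](skewCZ delta c 1) skewC1 Dk; apply: weight_le0.
  - case=> [|n]; first by rewrite (exp_map0 expD); apply: weight_C.
    have [-> | Du] := eqVneq (D n.+1 (C u)) 0; first exact: weight_le0.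
    apply: w_size; apply: (rs_max (_, _)).
    by rewrite mem_cat L1P // map_f.
  - by rewrite skewCD; apply: adaptedD.
  - by rewrite skewCM -[0%N]/(0 + 0)%N; apply: adaptedM.
have adaptedX : adapted s D r X s.
  case=> [|n].
    rewrite (exp_map0 expD) mul0n addn0; apply: w_size.
    by rewrite /skew_size size_polyX muln1.
  have [s1 | s2] := leqP (skew_size (D n.+1 X)) 1.
    by apply: w_size; case: (skew_size _) s1 => [|[|]] //; rewrite muln0.
  apply: w_size; have /= := rs_max (_, _) (_ : ((skew_size (D n.+1 X)).-2, n.+1) \in _).
  rewrite mem_cat L2P // orbT => /(_ isT).
  by case: (skew_size _) s2 => [|[|m]] //= _; rewrite mulnS leq_add2l.
have lead_X := leadingX sigma_id s_gt0 expD adaptedC adaptedX domB sp Dp.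
have expd := leading_exp_map sigma_id s_gt0 expD adaptedC adaptedX lead_X.
exists (leading_map s D r); case: s s_gt0 rsL {rs_max w_size adaptedC adaptedX} lead_X expd => // s _.
rewrite mem_cat => /orP[] /mapP[]; last first.
  move=> i; rewrite mem_filter => /andP[sX _] [rE sE] lead_X.
  have := lead_X s; rewrite /leading /top_coef -mulnS mulKn // dvdn_mulr // sE rE.
  case sD : (skew_size _) sX => [|[|m]] //= _ /eqP.
  by rewrite (negPf (skew_lead_neq0 sD)).
move=> [v i]; rewrite mem_filter => /andP[Dv /allpairsP[[w j]]] /= [/mapP[u _ ->] _ [vE iE]].
rewrite vE in Dv *; case=> rE sE _ expd; exists u, s; split=> //.
rewrite /leading_map /leading /top_coef add0n dvdn_mulr // mulKn // sE rE.
case sD : (skew_size _) => [|m].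
  by move: Dv; rewrite -skew_size_gt0 sD.
by apply/eqP; apply: skew_lead_neq0.
Qed.

End Homogenize.

(** * Translations and exponentials of derivations *)

Lemma nderivnM (A : comNzRingType) n (p q : {poly A}) :
  (p * q)^`N(n) = \sum_(i < n.+1) p^`N(i) * q^`N(n - i).
Proof.
have nderivnMX m (u : {poly A}) : (u * 'X)^`N(m.+1) = u^`N(m) + u^`N(m.+1) * 'X.
  by have := nderivnMXaddC m u 0; rewrite polyC0 addr0.
elim/poly_ind: p n => [|p c IHp] n.
  by rewrite mul0r linear0 big1 // => i _; rewrite linear0 mul0r.
rewrite mulrDl nderivnD; under [RHS]eq_bigr => i _ do rewrite nderivnD mulrDl.
rewrite big_split /=; congr (_ + _); last first.
  rewrite mul_polyC nderivnZ big_ord_recl big1 => [|i _].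
    by rewrite nderivn0 subn0 addr0 mul_polyC.
  by rewrite nderivnC mul0r.
case: n => [|n]; first by rewrite big_ord1 !nderivn0.
rewrite mulrAC nderivnMX !IHp [X in _ = X]big_ord_recl /= nderivn0 subn0.
rewrite [X in _ + X * _]big_ord_recl /= nderivn0 subn0.
under [X in _ = _ + X]eq_bigr => i _ do rewrite /bump add1n nderivnMX subSS mulrDl mulrAC.
rewrite big_split /= -mulr_suml mulrDl mulrAC addrCA.
congr (_ + (_ + _ * _)); by apply: eq_bigr => i _.
Qed.

Lemma nderivn_nderivn (A : nzRingType) i j (p : {poly A}) :
  p^`N(j)^`N(i) = p^`N(i + j) *+ 'C(i + j, i).
Proof.
apply/polyP => l; rewrite coefMn !coef_nderivn addnCA addnA -!mulrnA.
congr (_ *+ _).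
apply/eqP.
have binDE a b : ('C(a + b, a) * (a`! * b`!) = (a + b)`!)%N.
  by rewrite -(@bin_fact (a + b) a) ?leq_addr // addKn.
rewrite -(eqn_pmul2r (fact_gt0 i)) -(eqn_pmul2r (fact_gt0 j)) -(eqn_pmul2r (fact_gt0 l)).
have -> : ('C(i + j + l, j) * 'C(i + l, i) * i`! * j`! * l`! =
  'C(i + j + l, j) * (j`! * ('C(i + l, i) * (i`! * l`!))))%N by ring.
have -> : ('C(i + j + l, i + j) * 'C(i + j, i) * i`! * j`! * l`! =
  'C(i + j + l, i + j) * ('C(i + j, i) * (i`! * j`!) * l`!))%N by ring.
by rewrite !binDE -addnA addnCA binDE.
Qed.

Lemma exp_map_transport (k : comNzRingType) (R R' : algType k)
    (f : {lrmorphism R -> R'}) (g : {lrmorphism R' -> R}) (D : nat -> R -> R) :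
  cancel f g -> cancel g f -> exp_map D -> exp_map (fun n q => f (D n (g q))).
Proof.
move=> fK gK expD; split=> [q | n p q | n p q | q | i j q].
- by rewrite (exp_map0 expD) gK.
- by rewrite rmorphB (exp_mapB expD) rmorphB.
- rewrite rmorphM (exp_mapM expD) rmorph_sum.
  by apply: eq_bigr => i _; rewrite rmorphM.
- have [N NP] := exp_map_finite expD (g q).
  by exists N => n /NP ->; rewrite rmorph0.
by rewrite fK (exp_map_iter expD) rmorphMn.
Qed.

Section Derivation.
Variables (k : fieldType) (R : algType k) (E : {linear R -> R}).
Hypothesis chark : [pchar k] =i pred0.
Hypothesis EM : forall p q, E (p * q) = E p * q + p * E q.
Hypothesis E_nilpotent : forall p, exists N, iter N E p = 0.

Definition divided_power n p : R := (n`!%:R : k)^-1 *: iter n E p.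

Let nat_neq0 n : (n.+1%:R : k) != 0.
Proof. by rewrite (proj1 (pcharf0P k) chark). Qed.

Let fact_neq0 n : (n`!%:R : k) != 0.
Proof. by rewrite (proj1 (pcharf0P k) chark) -lt0n fact_gt0. Qed.

Let iterZ n c p : iter n E (c *: p) = c *: iter n E p.
Proof. by elim: n => //= n ->; rewrite linearZ. Qed.

Let divided_powerS n p :
  divided_power n.+1 p *+ n.+1 = E (divided_power n p).
Proof.
rewrite /divided_power linearZ /= -scaler_nat scalerA factS natrM invfM mulrA.
by rewrite divff ?mul1r.
Qed.

Lemma divided_power_exp_map : exp_map divided_power.
Proof.
have D0 p : divided_power 0 p = p by rewrite /divided_power invr1 scale1r.
split=> // [n p q | n p q | p | i j p].
- rewrite /divided_power -scalerBr; congr (_ *: _).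
  by elim: n => //= n ->; rewrite raddfB.
- elim: n => [|n IHn]; first by rewrite big_ord1 !D0.
  apply: (scalerI (nat_neq0 n)); rewrite !scaler_nat divided_powerS IHn.
  rewrite raddf_sum /=; pose F i := divided_power i p * divided_power (n.+1 - i) q.
  have EF (i : 'I_n.+1) : E (divided_power i p * divided_power (n - i) q)
      = F i.+1 *+ i.+1 + F i *+ (n.+1 - i).
    rewrite EM -!divided_powerS mulrnAl mulrnAr /F subSS subSn //.
    by rewrite -ltnS.
  rewrite (eq_bigr _ (fun i _ => EF i)) big_split /=.
  have -> : \sum_(i < n.+1) F i.+1 *+ i.+1 = \sum_(i < n.+2) F i *+ i.
    by rewrite [RHS]big_ord_recl mulr0n add0r.
  have -> : \sum_(i < n.+1) F i *+ (n.+1 - i) = \sum_(i < n.+2) F i *+ (n.+1 - i).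
    by rewrite [RHS]big_ord_recr /= subnn mulr0n addr0.
  rewrite -big_split /= -sumrMnl; apply: eq_bigr => i _.
  by rewrite -mulrnDr subnKC // -ltnS.
- have [N NP] := E_nilpotent p; exists N => n Nn.
  rewrite /divided_power -[in iter _ _ _](subnK Nn) iterD NP.
  suff -> : iter (n - N) E 0 = 0 by rewrite scaler0.
  by elim: (n - N)%N => //= m ->; rewrite linear0.
rewrite /divided_power iterZ scalerA -iterD -scaler_nat scalerA.
congr (_ *: _); rewrite -(@bin_fact (i + j) i) ?leq_addr // addKn !natrM.
have C_neq0 : ('C(i + j, i)%:R : k) != 0.
  by rewrite (proj1 (pcharf0P k) chark) -lt0n bin_gt0 leq_addr.
by field; rewrite !fact_neq0 C_neq0.
Qed.

End Derivation.

Section Skew.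
Variables (k : fieldType) (A : comAlgType k).
Variables (sigma : {lrmorphism A -> A}) (delta : skewder sigma).
Hypothesis sigma_id : forall a, sigma a = a.
Local Notation R := (skew_poly sigma delta).
Local Notation C := (skewC delta).
Implicit Types p q : R.

Lemma skew_mul_commutative : (forall a, delta a = 0) ->
  forall p q, p * q = (p : {poly A}) * (q : {poly A}) :> {poly A}.
Proof.
move=> delta0 p q; rewrite [p * q]/(skew_mul delta p q) /skew_mul.
rewrite -[in RHS](coefK (p : {poly A})) poly_def mulr_suml.
apply: eq_bigr => i _; rewrite -scalerAl; congr (_ *: _).
elim: (i : nat) => [|n IHn] /=; first by rewrite expr0 mul1r.
rewrite IHn exprS -mulrA; apply/polyP => j.
rewrite coef_skew_mulX delta0 addr0 sigma_id [in RHS]mulrC coefMX.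
by case: eqP.
Qed.

Lemma translation_exp_map : (forall a, delta a = 0) ->
  exp_map (fun n (p : R) => (nderivn n (p : {poly A}) : R)).
Proof.
move=> delta0; split=> [p | n p q | n p q | p | i j p].
- exact: nderivn0.
- exact: nderivnB.
- rewrite skew_mul_commutative // nderivnM.
  by apply: eq_bigr => i _; rewrite skew_mul_commutative.
- exists (size (p : {poly A})) => n; exact: nderivn_poly0.
exact: nderivn_nderivn.
Qed.

Lemma iter_sigma_id n a : iter n sigma a = a.
Proof. by elim: n => //= n ->. Qed.

Lemma skewC_scalar (c : k) : c%:A = C c%:A :> R.
Proof. by rewrite [RHS](skewCZ delta c 1) skewC1. Qed.

(** To leading order, x^(e+1) b - b x^(e+1) is (e + 1) delta(b) x^e. *)
Lemma skew_coef_bracketC p b e : skew_size p = e.+2 ->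
  skew_coef (p * C b - C b * p) e = skew_coef p e.+1 * delta b *+ e.+1.
Proof.
move=> sp; rewrite skew_coefB skew_coefCM /skew_coef.
have iterC i : (iter i (skew_mulX delta) (C b : {poly A}))`_i = b.
  have /= := @skew_coef_iter _ _ _ delta (C b) 0 i; rewrite addn0 => ->.
    by rewrite iter_sigma_id coefC.
  exact: size_polyC_leq1.
have iterC1 i : (iter i.+1 (skew_mulX delta) (C b : {poly A}))`_i = delta b *+ i.+1.
  elim: i => [|i IHi]; rewrite iterS coef_skew_mulX.
    by rewrite (iterC 0%N) add0r.
  by rewrite iterC /= IHi sigma_id -mulrSr.
rewrite [p * C b](@skew_mul_wide _ _ _ _ e.+2) -/(skew_size p) ?sp // coef_sum.
rewrite 2!big_ord_recr /= big1 => [|i _]; last first.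
  rewrite coefZ (leq_sizeP _ _ (@skew_size_iter _ _ _ delta (C b) 1 i _)) ?mulr0 //.
    exact: size_polyC_leq1.
  by rewrite addn1.
rewrite !coefZ iterC iterC1 add0r mulrC addrAC subrr add0r mulrnAr.
by [].
Qed.

Section Bracket.
Variable a : A.

Definition bracket p : R := C a * p - p * C a.

Fact bracket_linear : linear bracket.
Proof.
move=> c p q; rewrite /bracket mulrDr mulrDl -scalerAl -scalerAr scalerBr.
by rewrite opprD addrACA.
Qed.
HB.instance Definition _ := GRing.isLinear.Build k R R _ bracket bracket_linear.

Lemma bracketM p q : bracket (p * q) = bracket p * q + p * bracket q.
Proof. by rewrite /bracket mulrBl mulrBr !mulrA addrA subrK. Qed.

(** Bracketing with a constant cancels the leading term. *)
Lemma bracket_nilpotent p : exists N, iter N bracket p = 0.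
Proof.
have size_br q m : (skew_size q <= m.+1)%N -> (skew_size (bracket q) <= m)%N.
  move=> sq; have sC := skew_sizeC delta a.
  apply/skew_sizeP => i; rewrite leq_eqVlt skew_coefB => /orP[/eqP<-|mi].
    rewrite skew_coefCM -[X in skew_coef (q * _) X]addn0 (skew_coef_top sq sC).
    rewrite skew_coefC eqxx iter_sigma_id.
    by rewrite mulrC subrr.
  rewrite skew_coefCM !skew_coef_out ?mulr0 ?subrr //; last exact: leq_trans mi.
  by apply: leq_trans (skew_size_mul sq sC) _; rewrite addn0.
have size_iter n : (n <= skew_size p)%N ->
    (skew_size (iter n bracket p) <= skew_size p - n)%N.
  elim: n => [|n IHn] np; first by rewrite subn0.
  by apply: size_br; rewrite subnSK //; apply/IHn/ltnW.
exists (skew_size p); apply/eqP; rewrite -[_ == _]negbK -skew_size_gt0 -leqNgt.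
by have := size_iter _ (leqnn _); rewrite subnn.
Qed.

End Bracket.

End Skew.

(** * Exponential maps carried across an isomorphism *)

Section Carried.
Variables (k : fieldType) (A B : comAlgType k).
Hypotheses (domB : GRing.integral_domain_axiom B) (affB : affine_alg B).
Hypothesis dimB : has_krull_dim B 1.
Variables (sigma : {lrmorphism A -> A}) (delta : skewder sigma).
Variables (sigma' : {lrmorphism B -> B}) (delta' : skewder sigma').
Hypothesis sigma'_id : forall b, sigma' b = b.
Local Notation R := (skew_poly sigma delta).
Local Notation R' := (skew_poly sigma' delta').
Variables (f : {lrmorphism R -> R'}) (g : {lrmorphism R' -> R}).
Hypotheses (fK : cancel f g) (gK : cancel g f).

(** The fixed coefficient [a] becomes a fixed element of positive degree of R', which
    is what the passage to leading forms requires. *)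
Lemma carried_line (D : nat -> R -> R) a b n : exp_map D ->
    (forall m (c : k), D m.+1 c%:A = 0) ->
    (forall m, D m.+1 (skewC delta a) = 0) ->
    (1 < skew_size (f (skewC delta a)))%N -> D n.+1 (g (skewC delta' b)) <> 0 ->
  exists t : B, line_over_units t.
Proof.
move=> expD Dk Da fa Dgb; have [us gen_us] := affine_generates affB.
have [e se] : exists e, skew_size (f (skewC delta a)) = e.+2.
  by case: (skew_size _) fa => [|[|e]] // _; exists e.
have expD' := exp_map_transport fK gK expD.
have D'k m (c : k) : f (D m.+1 (g c%:A)) = 0.
  by rewrite linearZ /= rmorph1 Dk rmorph0.
have D'a m : f (D m.+1 (g (f (skewC delta a)))) = 0.
  by rewrite fK Da rmorph0.
have D'b : f (D n.+1 (g (skewC delta' b))) <> 0.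
  by move=> Db0; apply: Dgb; apply: (can_inj fK); rewrite Db0 rmorph0.
have [d [b' [m [expd db']]]] :=
  exp_map_coefficients sigma'_id domB gen_us expD' D'k se D'a D'b.
exact: (@exp_map_line k (dom_of domB) (in_alg B) us d gen_us expd (proj2 dimB) b' m.+1).
Qed.

End Carried.

(** * Trivial automorphisms *)

Section TrivialAutomorphism.
Variable k : fieldType.

Lemma skew_commutative (A : comAlgType k) (sigma : {lrmorphism A -> A})
    (delta : skewder sigma) :
  (forall p q : skew_poly sigma delta, p * q = q * p) <->
  (forall a, sigma a = a) /\ (forall a, delta a = 0).
Proof.
split=> [comm | [sigma_id delta0] p q]; last first.
  by apply: etrans (skew_mul_commutative sigma_id delta0 p q) _;
    rewrite mulrC; apply/esym/skew_mul_commutative.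
have XC a : skewC delta (sigma a) * skewX delta + skewC delta (delta a)
    = skewC delta a * skewX delta by rewrite -skewXC comm.
split=> a; [have := congr1 (fun p => skew_coef p 1) (XC a)
  | have := congr1 (fun p => skew_coef p 0) (XC a)];
  rewrite skew_coefD !skew_coefCM -[skewX delta]expr1 !skew_coefXn skew_coefC /=.
  by rewrite addr0 !mulr1.
by rewrite !mulr0 add0r.
Qed.

Section Line.
Variables (A B : comAlgType k).
Hypotheses (domB : GRing.integral_domain_axiom B) (affB : affine_alg B).
Hypothesis dimB : has_krull_dim B 1.
Variables (sigma : {lrmorphism A -> A}) (delta : skewder sigma).
Variables (sigma' : {lrmorphism B -> B}) (delta' : skewder sigma').
Hypothesis sigma_id : forall a, sigma a = a.
Hypothesis sigma'_id : forall b, sigma' b = b.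
Local Notation R := (skew_poly sigma delta).
Local Notation R' := (skew_poly sigma' delta').
Variables (f : {lrmorphism R -> R'}) (g : {lrmorphism R' -> R}).
Hypotheses (fK : cancel f g) (gK : cancel g f).

Lemma translation_line a b : (forall a, delta a = 0) ->
    (1 < skew_size (f (skewC delta a)))%N ->
    (1 < skew_size (g (skewC delta' b)))%N ->
  exists t : B, line_over_units t.
Proof.
move=> delta0 fa gb; have expD := translation_exp_map sigma_id delta0.
have [e se] : exists e, skew_size (g (skewC delta' b)) = e.+2.
  by case: (skew_size _) gb => [|[|e]] // _; exists e.
apply: (carried_line domB affB dimB sigma'_id fK gK expD (n := e) (b := b) _ _ fa).
- by move=> m c; rewrite skewC_scalar; apply: nderivnC.
- by move=> m; apply: nderivnC.
move=> /(congr1 (fun p : R => skew_coef p 0)).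
rewrite skew_coef0 /skew_coef coef_nderivn addn0 binn => /eqP.
by rewrite (negPf (skew_lead_neq0 se)).
Qed.

Lemma bracket_line a b : [pchar k] =i pred0 ->
    (1 < skew_size (f (skewC delta a)))%N -> delta' b <> 0 ->
  exists t : B, line_over_units t.
Proof.
move=> chark fa db; pose E : {linear R -> R} := bracket a.
have expD := divided_power_exp_map chark (E := E) (@bracketM _ _ _ delta a)
  (bracket_nilpotent sigma_id a).
have [e se] : exists e, skew_size (f (skewC delta a)) = e.+2.
  by case: (skew_size _) fa => [|[|e]] // _; exists e.
have iterE m p : E p = 0 -> divided_power E m.+1 p = 0.
  move=> Ep; rewrite /divided_power iterSr Ep.
  suff -> : iter m E 0 = 0 by rewrite scaler0.
  by elim: m => //= m ->; rewrite linear0.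
apply: (carried_line domB affB dimB sigma'_id fK gK expD (n := 0) (b := b) _ _ fa).
- move=> m c; apply: iterE; rewrite linearZ /=.
  by rewrite /bracket mulr1 mul1r subrr scaler0.
- by move=> m; apply: iterE; rewrite /= /bracket subrr.
rewrite /divided_power /= invr1 scale1r => /(congr1 f).
rewrite rmorph0 /bracket rmorphB !rmorphM /= gK.
move=> /(congr1 (fun p : R' => skew_coef p e)).
rewrite (skew_coef_bracketC sigma'_id _ se) skew_coef0 -mulr_natr => /domB.
have /negPf -> : (e.+1%:R : B) != 0.
  have := proj1 (pcharf0P k) chark e.+1 => /= e0.
  rewrite -(rmorph_nat (in_alg B)) fmorph_eq0 e0 //.
rewrite orbF => /eqP/domB; rewrite (negPf (skew_lead_neq0 se)) /=.
by move/eqP.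
Qed.

End Line.

Variables (A B : comAlgType k).
Hypotheses (domA : GRing.integral_domain_axiom A).
Hypotheses (domB : GRing.integral_domain_axiom B).
Hypotheses (affA : affine_alg A) (affB : affine_alg B).
Hypotheses (dimA : has_krull_dim A 1) (dimB : has_krull_dim B 1).
Variables (sigma : {lrmorphism A -> A}) (delta : skewder sigma).
Variables (sigma' : {lrmorphism B -> B}) (delta' : skewder sigma').
Hypothesis sigma_id : forall a, sigma a = a.
Hypothesis sigma'_id : forall b, sigma' b = b.

(** If neither coefficient ring is mapped into the other, then each gets a nontrivial
    exponential map: from translations if R and R' are commutative, and otherwise from
    exp(ad a) for some a, which moves every b with delta'(b) nonzero. *)
Lemma derivation_case :
    (forall a, delta a = 0) \/ [pchar k] =i pred0 ->
    alg_iso (skew_poly sigma delta) (skew_poly sigma' delta') ->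
  alg_iso A B.
Proof.
move=> zero_or_char [f f_bij]; have [g [fK gK]] := lrmorphism_inverse f_bij.
have g_bij : bijective g by exists f.
have sigma_inj : injective sigma by move=> x y; rewrite !sigma_id.
have sigma'_inj : injective sigma' by move=> x y; rewrite !sigma'_id.
have [fC | ] := pselect (forall a, skew_size (f (skewC delta a)) <= 1)%N.
  exact: (const_iso domB sigma'_inj f_bij fC).
have [gC _ | ] := pselect (forall b, skew_size (g (skewC delta' b)) <= 1)%N.
  exact/alg_iso_sym/(const_iso domA sigma_inj g_bij gC).
move=> /existsNP[b /negP]; rewrite -ltnNge => gb /existsNP[a /negP]; rewrite -ltnNge => fa.
suff [[s lineA] [t lineB]] : (exists s : A, line_over_units s) /\
    (exists t : B, line_over_units t).
  exact: (lines_iso domA domB sigma_inj sigma'_inj f_bij lineA lineB).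
have [delta0 | /existsNP[a' da']] := pselect (forall a, delta a = 0).
  have [_ delta'0] : (forall b, sigma' b = b) /\ (forall b, delta' b = 0).
    apply/skew_commutative => p q; apply: (can_inj gK).
    by rewrite !rmorphM; apply: (proj2 (skew_commutative delta)).
  split; first exact: (translation_line domA affA dimA sigma'_id sigma_id gK fK delta'0 gb fa).
  exact: (translation_line domB affB dimB sigma_id sigma'_id fK gK delta0 fa gb).
have chark : [pchar k] =i pred0.
  by case: zero_or_char => // delta0; case: da'.
have [b' db'] : exists b', delta' b' <> 0.
  apply/existsNP => delta'0; apply: da'; move: a'.
  suff [] : (forall a, sigma a = a) /\ (forall a, delta a = 0) by [].
  apply/skew_commutative => p q; apply: (can_inj fK).
  by rewrite !rmorphM; apply: (proj2 (skew_commutative delta')).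
split; first exact: (bracket_line domA affA dimA sigma'_id sigma_id gK fK chark gb da').
exact: (bracket_line domB affB dimB sigma_id sigma'_id fK gK chark fa db').
Qed.

End TrivialAutomorphism.

(** * Nontrivial automorphisms *)

Section OneDimensional.
Variables (A B : idomainType).
Hypothesis dimA : forall n (P : 'I_n.+1 -> {pred A}), prime_chain P -> (n <= 1)%N.
Hypothesis dimB : has_krull_dim B 1.

Lemma nonzero_prime : exists (L : idomainType) (eps : {rmorphism B -> L}) y,
  y <> 0 /\ eps y = 0.
Proof.
have [[P [primeP chainP]] _] := dimB.
have [_ /existsNP[y /not_implyP[y1 y0]]] := chainP ord0 (lift ord0 ord0) isT.
have [L [eps [_ epsP]]] := prime_quotient (primeP (lift ord0 ord0)).
exists L, eps, y; split; last by apply/eqP; rewrite epsP.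
move=> yE; apply: y0; rewrite yE.
by have [[]] := primeP ord0.
Qed.

Variable g : {rmorphism A -> B}.

(** A kernel and the preimage of a nonzero prime of [B] would extend 0 to a chain of
    length two. *)
Lemma onto_injective : (forall b, exists a, g a = b) -> injective g.
Proof.
move=> surj; have [L [eps [y [y0 epsy]]]] := nonzero_prime.
have [a ga] := surj y; apply: raddf_inj => x gx.
apply: (@kernel_chain _ dimA _ _ g (eps \o g) _ a) => //=.
- by move=> z ->; rewrite rmorph0.
- by rewrite ga.
by rewrite ga.
Qed.

(** The kernel, being nonzero, is a maximal ideal. *)
Lemma image_field a0 a : a0 <> 0 -> g a0 = 0 -> g a <> 0 -> exists a', g (a * a') = 1.
Proof.
move=> a00 ga0 ga; apply: contrapT => noinv; apply: a00.
pose I := [pred x | `[< exists b, g x = g (a * b) >]].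
have [||M [primeM sIM _ _]] := @prime_avoiding A I 1.
- split=> [|c u v /asboolP[x ux] /asboolP[y vy]].
    by apply/asboolP; exists 0; rewrite mulr0.
  apply/asboolP; exists (c * x + y).
  have -> : g (c * u + v) = g c * g u + g v by rewrite rmorphD rmorphM.
  by rewrite ux vy -rmorphM -rmorphD; congr (g _); ring.
- move=> N; rewrite expr1n; apply/asboolP => -[b gb].
  by apply: noinv; exists b; rewrite -gb rmorph1.
have [L [eps [_ epsM]]] := prime_quotient primeM.
apply: (@kernel_chain _ dimA _ _ g eps _ a) => // [x gx|].
  apply/eqP; rewrite epsM; apply: sIM; apply/asboolP.
  by exists 0; rewrite mulr0 rmorph0.
by apply/eqP; rewrite epsM; apply: sIM; apply/asboolP; exists 1; rewrite mulr1.
Qed.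

Variables (t : B) (a0 : A).
Hypotheses (a0_neq0 : a0 <> 0) (ga0 : g a0 = 0).
Hypothesis span : forall b, exists p : {poly A}, (map_poly g p).[t] = b.

(** Otherwise [B] would be algebraic over the field g(A), hence a field. *)
Lemma image_transcendental (p : {poly A}) : (map_poly g p).[t] = 0 -> map_poly g p = 0.
Proof.
move=> pt; apply: contrapT => /eqP p0; have [L [eps [y [y0 epsy]]]] := nonzero_prime.
pose l := p`_(size (map_poly g p)).-1.
have lE : g l = lead_coef (map_poly g p) by rewrite lead_coefE coef_map.
have gl : g l <> 0 by rewrite lE; apply/eqP; rewrite lead_coef_eq0.
have [l' ll'] := image_field a0_neq0 ga0 gl.
have int_t : integralOver g t.
  apply: (@integral_root_monic _ _ _ _ (g l' *: map_poly g p)).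
  - by rewrite monicE lead_coefZ -lE -rmorphM mulrC ll'.
  - by rewrite rootE hornerZ pt mulr0.
  by apply/integral_poly => i; rewrite coefZ coef_map -rmorphM; apply: integral_id.
have int_y : integralOver g y.
  have [q <-] := span y; apply: integral_horner => //.
  by apply/integral_poly => i; rewrite coef_map; apply: integral_id.
have [w [z [gw _ yz]]] := integral_cofactor (introN eqP y0) int_y.
have [w' ww'] := image_field a0_neq0 ga0 (elimN eqP gw).
have : eps (y * z * g w') = 1 by rewrite yz -rmorphM ww' rmorph1.
by move/eqP; rewrite -mulrA rmorphM epsy mul0r eq_sym oner_eq0.
Qed.

Lemma image_unit0 v : unit0 v <-> exists a, g a = v.
Proof.
split=> [[-> | [v' vv']] | [a <-]].
- by exists 0; rewrite rmorph0.
- have [[p pt] [q qt]] := (span v, span v').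
  have pq : map_poly g p * map_poly g q = 1.
    apply/eqP; rewrite -subr_eq0 -(rmorph1 (map_poly g)) -rmorphM -rmorphB.
    apply/eqP/image_transcendental.
    by rewrite rmorphB rmorphM rmorph1 hornerD hornerN hornerM pt qt vv' hornerC subrr.
  have /size1_polyC pC : (size (map_poly g p) <= 1)%N.
    have := congr1 (fun u : {poly B} => size u) pq; rewrite size_poly1.
    have [-> | p0] := eqVneq (map_poly g p) 0; first by rewrite mul0r size_poly0.
    have [-> | q0] := eqVneq (map_poly g q) 0; first by rewrite mulr0 size_poly0.
    rewrite size_mul // -[size (map_poly g q)]prednK ?size_poly_gt0 // addnS /=.
    by move=> spq; apply: leq_trans (leq_addr _ _) (eq_leq spq).
  by exists p`_0; rewrite -pt pC hornerC coef_map.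
have [ga | ga] := eqVneq (g a) 0; [by left | right].
have [a' aa'] := image_field a0_neq0 ga0 (elimN eqP ga).
by exists (g a'); rewrite -rmorphM.
Qed.

Lemma image_line : line_over_units t.
Proof.
split=> [u v /image_unit0[a <-] /image_unit0[b <-] | b | p up pt].
- by apply/image_unit0; exists (a + b); rewrite rmorphD.
- have [p pb] := span b; exists (map_poly g p) => // i.
  by rewrite coef_map; apply/image_unit0; exists p`_i.
have /choice[u uP] i : exists a, g a = p`_i by apply/image_unit0.
have pE : p = map_poly g (\poly_(i < size p) u i).
  apply/polyP => i; rewrite coef_map coef_poly /=; case: ltnP => [_ | pi].
    by rewrite uP.
  by rewrite rmorph0 (leq_sizeP _ _ (leqnn _)).
by rewrite pE; apply: image_transcendental; rewrite -pE.
Qed.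

End OneDimensional.

(** Units of [A] are fixed by [sigma], since [g] is injective on them and does not see
    [sigma]. An automorphism of U[s] over U sends s to q1 s + q0. If q1 = 1, then g(q0) = 0
    makes [sigma] trivial; otherwise [g] identifies s with the fixed point q0 / (1 - q1). *)
Lemma fixed_point (A B : idomainType) (s : A) (g : {rmorphism A -> B})
    (sigma tau : {rmorphism A -> A}) :
    line_over_units s -> cancel tau sigma -> ~ (forall a, sigma a = a) ->
    (forall a, g (sigma a) = g a) ->
  exists2 w, unit0 w & g w = g s.
Proof.
move=> lineA tauK sigmaN1 g_sigma.
have unitB (u v : A) : unit0 u -> unit0 v -> unit0 (u - v).
  by move=> uu uv; apply: (unit0D lineA) => //; apply: unit0N.
have g_unit (u : A) : unit0 u -> g u = 0 -> u = 0.
  move=> [-> // | [v uv]] gu; have := congr1 g uv.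
  by rewrite rmorphM gu mul0r rmorph1 => /eqP; rewrite eq_sym oner_eq0.
have sigma_unit (u : A) : unit0 u -> unit0 (sigma u).
  by case=> [->|[v uv]]; [left; rewrite rmorph0 | right; exists (sigma v); rewrite -rmorphM uv rmorph1].
have sigma_fix (u : A) : unit0 u -> sigma u = u.
  move=> uu; apply/eqP; rewrite -subr_eq0; apply/eqP/g_unit.
    by apply: unitB => //; apply: sigma_unit.
  by rewrite rmorphB g_sigma subrr.
have sigmaP (p : {poly A}) : (forall i, unit0 p`_i) -> sigma p.[s] = p.[sigma s].
  move=> up; rewrite -horner_map; congr (_.[_]); apply/polyP => i.
  by rewrite coef_map /= sigma_fix.
have [q uq qs] := line_span lineA (sigma s).
have [q' uq' q's] := line_span lineA (tau s).
have comp_unit (p : {poly A}) : (forall i, unit0 p`_i) -> forall i, unit0 (p \Po q)`_i.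
  have sum_unit n (F : 'I_n -> A) : (forall i, unit0 (F i)) -> unit0 (\sum_i F i).
    move=> uF; elim/big_rec: _ => [|i a _ ua]; first by left.
    exact: (unit0D lineA).
  have exp_unit n i : unit0 (q ^+ n)`_i.
    elim: n i => [|n IHn] i.
      by rewrite expr0 coef1; case: eqP => _; [apply: unit01 | left].
    by rewrite exprS coefM; apply: sum_unit => j; apply: unit0M.
  move=> up i; rewrite comp_polyE coef_sum; apply: sum_unit => j.
  by rewrite coefZ; apply: unit0M.
have qq' : q' \Po q = 'X.
  apply/eqP; rewrite -subr_eq0; apply/eqP/(line_free lineA) => [i|].
    rewrite coefB; apply: unitB; first exact: comp_unit.
    by rewrite coefX; case: eqP => _; [apply: unit01 | left].
  by rewrite hornerD hornerN horner_comp qs -sigmaP // q's tauK hornerX subrr.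
have sq : size q = 2%N.
  have := size_comp_poly q' q; rewrite qq' size_polyX /= => /esym/eqP.
  by rewrite muln_eq1 => /andP[_]; case: (size q) => [|[|[|]]].
have sE : sigma s = q`_1 * s + q`_0.
  by rewrite -qs horner_coef sq big_ord_recl big_ord1 /= expr0 expr1 mulr1 addrC.
have [q1 | q1] := eqVneq (q`_1 - 1) 0.
  case: sigmaN1 => a; have [p up <-] := line_span lineA a; rewrite sigmaP //.
  congr (_.[_]); rewrite sE; move/eqP: q1; rewrite subr_eq0 => /eqP q1.
  rewrite q1 mul1r (g_unit q`_0) ?addr0 //.
  by have := g_sigma s; rewrite sE q1 mul1r rmorphD => /(canRL (addKr _)); rewrite addNr.
have [/eqP|[v qv]] := unitB _ _ (uq 1%N) (unit01 A); first by rewrite (negPf q1).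
exists (- (v * q`_0)).
  by apply/unit0N/unit0M => //; right; exists (q`_1 - 1); rewrite mulrC.
have := g_sigma s; rewrite sE => gs.
transitivity (g ((q`_1 - 1) * v * s)); last by rewrite qv mul1r.
transitivity (g (- (v * q`_0)) + g v * (g (q`_1 * s + q`_0) - g s)).
  by rewrite gs subrr mulr0 addr0.
by rewrite -rmorphB -rmorphM -rmorphD; congr (g _); ring.
Qed.

Section ConstantTerm.
Variables (k : fieldType) (A : comAlgType k) (sigma : {lrmorphism A -> A}).
Local Notation R := (skew_poly sigma (skewder0 sigma)).

Lemma constant_term_morphism :
  exists h : {lrmorphism R -> A}, forall p, h p = skew_coef p 0.
Proof.
apply: lrmorphism_of => [p q | | c p]; last exact: skew_coefZ.
  exact: skew_coefB.
split=> [|p q]; first exact: coef1.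
rewrite /skew_coef [p * q](skew_mul_wide _ _ (leqnSn _)).
rewrite big_ord_recl coefD coefZ coef_sum big1 ?addr0 // => i _.
by rewrite coefZ /= coef_skew_mulX addr0 mulr0.
Qed.

Variables (B : comAlgType k) (h : {lrmorphism R -> B}).

Lemma restrict_skewC :
  exists g : {lrmorphism A -> B}, forall a, g a = h (skewC _ a).
Proof.
apply: lrmorphism_of => [a b | | c a].
- by rewrite -rmorphB; congr (h _); apply: polyCB.
- by split=> [|a b]; rewrite ?skewC1 ?rmorph1 // skewCM rmorphM.
by rewrite skewCZ linearZ.
Qed.

Lemma horner_skew (g : {lrmorphism A -> B}) : (forall a, g a = h (skewC _ a)) ->
  forall p, h p = (map_poly g (p : {poly A})).[h (skewX _)].
Proof.
move=> gE p; rewrite {1}[p]skew_polyE rmorph_sum.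
rewrite (horner_coef_wide _ (size_poly _ _)); apply: eq_bigr => i _.
by rewrite coef_map rmorphM rmorphXn /= gE.
Qed.

Lemma skewX_commutation (g : {lrmorphism A -> B}) : (forall a, g a = h (skewC _ a)) ->
  forall a, h (skewX _) * g a = g (sigma a) * h (skewX _).
Proof.
by move=> gE a; rewrite !gE -!rmorphM skewXC skewC0 addr0.
Qed.

End ConstantTerm.

Section Automorphism.
Variables (k : fieldType).

(** Composing [f] with the constant term gives a surjection h of R onto [B], and
    h(x) h(a) = h(sigma(a)) h(x). If h(x) = 0, then [A] already maps onto [B].
    Otherwise h identifies a and sigma(a), so its restriction [g] to [A] has a kernel,
    and [B] is generated by h(x) over the field g(A). *)
Lemma constant_term_cases (A B : comAlgType k)
    (domA : GRing.integral_domain_axiom A) (domB : GRing.integral_domain_axiom B)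
    (dimA : has_krull_dim A 1) (dimB : has_krull_dim B 1)
    (sigma : {lrmorphism A -> A}) (sigma' : {lrmorphism B -> B})
    (f : {lrmorphism skew_poly sigma (skewder0 sigma) ->
                     skew_poly sigma' (skewder0 sigma')}) :
    bijective f -> ~ (forall a, sigma a = a) ->
  alg_iso A B \/
  exists (g : {lrmorphism A -> B}) (t : B), [/\ line_over_units t,
    forall a, g (sigma a) = g a & forall v, unit0 v <-> exists a, g a = v].
Proof.
move=> f_bij sigmaN1; have [f' [fK f'K]] := lrmorphism_inverse f_bij.
have [ev evE] := constant_term_morphism sigma'.
pose h : {lrmorphism _ -> B} := ev \o f.
have [g gE] := restrict_skewC h.
have hE := horner_skew gE; have hX := skewX_commutation gE.
set t := h _ in hE hX.
have span b : exists p : {poly A}, (map_poly g p).[t] = b.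
  exists (f' (skewC _ b)).
  by rewrite -hE /h /= f'K evE skew_coefC.
have [t0 | t0] := eqVneq t 0.
  left; exists g; apply: inj_surj_bij => [|b].
    apply: (@onto_injective (dom_of domA) (dom_of domB) (proj2 dimA) dimB g) => b.
    have [p <-] := span b; exists p`_0.
    by rewrite t0 horner_coef0 coef_map.
  have [p <-] := span b; exists p`_0.
  by rewrite t0 horner_coef0 coef_map.
right; exists g, t.
have g_sigma a : g (sigma a) = g a.
  have /eqP := hX a; rewrite -subr_eq0 [g _ * _]mulrC -mulrBr => /eqP/domB.
  by rewrite (negPf t0) subr_eq0 => /eqP.
have [a0 a00] : exists a, sigma a - a <> 0.
  apply: contrapT => noa; apply: sigmaN1 => a; apply: contrapT => sa.
  by apply: noa; exists a => /eqP; rewrite subr_eq0 => /eqP.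
have ga0 : g (sigma a0 - a0) = 0 by rewrite rmorphB /= g_sigma subrr.
split=> //.
  exact: (@image_line (dom_of domA) (dom_of domB) (proj2 dimA) dimB g t _ a00 ga0 span).
exact: (@image_unit0 (dom_of domA) (dom_of domB) (proj2 dimA) dimB g t _ a00 ga0 span).
Qed.

(** Here the units of [A] and [B] are compared through [g] rather than [f]: both
    g(A) and the image of the units of [A] are the units of [B], by [fixed_point]. *)
Lemma automorphism_case (A B : comAlgType k)
    (domA : GRing.integral_domain_axiom A) (domB : GRing.integral_domain_axiom B)
    (dimA : has_krull_dim A 1) (dimB : has_krull_dim B 1)
    (sigma : {lrmorphism A -> A}) (sigma' : {lrmorphism B -> B}) :
    bijective sigma -> ~ (forall a, sigma a = a) -> ~ (forall b, sigma' b = b) ->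
    alg_iso (skew_poly sigma (skewder0 sigma))
            (skew_poly sigma' (skewder0 sigma')) ->
  alg_iso A B.
Proof.
move=> sigma_bij sigmaN1 sigma'N1 [f f_bij].
have [f' [fK f'K]] := lrmorphism_inverse f_bij.
have f'_bij : bijective f' by exists f.
have [// | [g [t [lineB g_sigma unitB]]]] :=
  constant_term_cases domA domB dimA dimB f_bij sigmaN1.
have [isoBA | [g' [s [lineA _ _]]]] :=
  constant_term_cases domB domA dimB dimA f'_bij sigma'N1.
  exact: alg_iso_sym.
have [tau [_ tauK]] := lrmorphism_inverse sigma_bij.
have [w uw gw] := @fixed_point (dom_of domA) (dom_of domB) s g sigma tau lineA tauK sigmaN1 g_sigma.
apply: (line_transfer lineA lineB (h := g)) => [u v _ _|u v _ _|c|u uu|u uu gu|v /unitB[a <-]].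
- exact: rmorphD.
- exact: rmorphM.
- by rewrite linearZ /= rmorph1.
- by apply/unitB; exists u.
- case: uu => // -[v uv]; have := congr1 g uv.
  by rewrite rmorphM /= gu mul0r rmorph1 => /eqP; rewrite eq_sym oner_eq0.
have [p up <-] := line_span lineA a; exists p.[w]; last first.
  by rewrite -!horner_map gw.
rewrite horner_coef; elim/big_rec: _ => [|i x _ ux]; first by left.
apply: (unit0D lineA) => //; apply: unit0M => //.
by elim: (i : nat) => [|n IHn]; rewrite ?expr0 ?exprS; [apply: unit01 | apply: unit0M].
Qed.

End Automorphism.

(** * The cancellation theorem *)

Theorem theorem1p2 (k : fieldType) (A B : comAlgType k)
  (domA : GRing.integral_domain_axiom A) (domB : GRing.integral_domain_axiom B)
  (affA : affine_alg A) (affB : affine_alg B)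
  (dimA : has_krull_dim A 1) (dimB : has_krull_dim B 1)
  (sigma : {lrmorphism A -> A}) (sigma' : {lrmorphism B -> B})
  (autA : bijective sigma) (autB : bijective sigma')
  (delta : skewder (@idfun A)) (delta' : skewder (@idfun B)) :
  (alg_iso (skew_poly sigma (skewder0 sigma))
           (skew_poly sigma' (skewder0 sigma')) -> alg_iso A B) /\
  ([pchar k] =i pred0 ->
   alg_iso (skew_poly idfun delta) (skew_poly idfun delta') -> alg_iso A B).
Proof.
split=> [iso | chark iso]; last first.
  by apply: (derivation_case domA domB affA affB dimA dimB _ _ _ iso) => //; right.
have zeroA a : skewder0 sigma a = 0 by [].
have comm_id (C D : comAlgType k) (rho : {lrmorphism C -> C}) (rho' : {lrmorphism D -> D}) :
    alg_iso (skew_poly rho (skewder0 rho)) (skew_poly rho' (skewder0 rho')) ->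
    (forall c, rho c = c) -> forall d, rho' d = d.
  case=> f /lrmorphism_inverse[g [fK gK]] rho_id.
  suff [] : (forall d, rho' d = d) /\ (forall d, skewder0 rho' d = 0) by [].
  apply/skew_commutative => p q; apply: (can_inj gK); rewrite !rmorphM.
  by apply: (proj2 (skew_commutative (skewder0 rho))).
have [sigma_id | sigmaN1] := pselect (forall a, sigma a = a).
  have sigma'_id := comm_id _ _ _ _ iso sigma_id.
  by apply: (derivation_case domA domB affA affB dimA dimB sigma_id sigma'_id _ iso); left.
apply: (automorphism_case domA domB dimA dimB autA sigmaN1 _ iso).
by move=> sigma'_id; apply: sigmaN1; apply: comm_id sigma'_id; apply: alg_iso_sym.
Qed.
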